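(* Let $p\in(0,1)$ be fixed. Given $n$, let $m=m(n)=\lfloor p\binom n2\rfloor$. Let $G$ be a random graph chosen either according to $G(n,m)$ or according to $G(n,p)$. Then, with probability tending to $1$ as $n\to\infty$, $$\operatorname{bc}(G)\sim\operatorname{bp}(G)\sim\frac{h_2(p)}2\cdot\frac{n^2}{\lg n}.$$
   Context: All graphs are finite, simple and undirected; $\lg$ is the base-2 logarithm; $h_2(x)=-x\lg x-(1-x)\lg(1-x)$ is the binary entropy function. $G(n,p)$ is the binomial random graph on $n$ vertices in which each edge is included independently with probability $p$; $G(n,m)$ is a uniformly random element of the set of all graphs on $n$ labelled vertices with exactly $m$ edges. A biclique of a graph $G$ is a (not necessarily induced) complete bipartite subgraph of $G$. A biclique covering of $G$ is a family $\{B_1,\dots,B_k\}$ of bicliques of $G$ with $E(G)=\bigcup_iE(B_i)$; it is a biclique partition if the $E(B_i)$ are pairwise disjoint. Its weight is $\sum_i|V(B_i)|$. $\operatorname{bc}(G)$ (respectively $\operatorname{bp}(G)$) is the minimum weight of a biclique covering (respectively biclique partition) of $G$. The statement ''$X(G)\sim f(n)$ with probability tending to $1$'' means $X(G)=(1+o(1))f(n)$ with probability $1-o(1)$. *)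

(* Defs.v *)
From HB Require Import structures.
From mathcomp Require Import all_boot all_order all_algebra.

Set Implicit Arguments.
Unset Strict Implicit.
Unset Printing Implicit Defensive.

Import Order.TTheory GRing.Theory Num.Theory.

Local Open Scope ring_scope.
Local Open Scope set_scope.

Section Graphs.
Variable n : nat.

Definition edge := {e : {set 'I_n} | #|e| == 2%N}.

(* A graph on the labelled vertices 0, ..., n-1 is its edge set. *)
Definition graph := {set edge}.

(* A pair (X, Y) stands for the complete bipartite graph with parts X and Y
   as soon as X and Y are nonempty and disjoint.  The pair (Y, X) then stands
   for the same graph; counting it separately does not affect minimum
   weights. *)
Definition parts : Type := ({set 'I_n} * {set 'I_n})%type.

Definition bicliqueV (B : parts) : {set 'I_n} := B.1 :|: B.2.

Definition bicliqueE (B : parts) : {set edge} :=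
  [set e : edge | [exists x in B.1, exists y in B.2, val e == [set x; y]]].

Definition is_biclique (G : graph) (B : parts) : bool :=
  [&& B.1 != set0, B.2 != set0, [disjoint B.1 & B.2] & bicliqueE B \subset G].

Definition biclique_covering (G : graph) (F : {set parts}) : bool :=
  [forall B in F, is_biclique G B] && (G == \bigcup_(B in F) bicliqueE B).

Definition biclique_partition (G : graph) (F : {set parts}) : bool :=
  biclique_covering G F &&
  [forall B in F, forall C in F,
     (B != C) ==> [disjoint bicliqueE B & bicliqueE C]].

Definition weight (F : {set parts}) : nat := (\sum_(B in F) #|bicliqueV B|)%N.

Definition covering_weight (G : graph) : pred nat :=
  fun w => [exists F, biclique_covering G F && (weight F == w)].

Definition partition_weight (G : graph) : pred nat :=
  fun w => [exists F, biclique_partition G F && (weight F == w)].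

(* Each edge is a biclique, so G has a biclique partition. *)
Lemma biclique_partition_exists (G : graph) : exists F, biclique_partition G F.
Proof.
pose Q (u : 'I_n * 'I_n) :=
  (u.1 < u.2)%N && [exists e in G, val e == [set u.1; u.2]].
pose g (u : 'I_n * 'I_n) : parts := ([set u.1], [set u.2]).
have Eg u (e : edge) : (e \in bicliqueE (g u)) = (val e == [set u.1; u.2]).
  rewrite inE; apply/existsP/idP => [[x /andP[/set1P->]]|ue].
    by case/existsP=> y /andP[/set1P->].
  exists u.1; rewrite set11; apply/existsP.
  by exists u.2; rewrite set11.
exists [set g u | u in [set u | Q u]].
apply/andP; split; last first.
  apply/forall_inP => B /imsetP[u]; rewrite inE => /andP[ltu _] ->.
  apply/forall_inP => C /imsetP[v]; rewrite inE => /andP[ltv _] ->.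
  apply/implyP; apply: contraNT => /pred0Pn[e /andP[/=]].
  rewrite !Eg => /eqP-> /eqP Euv.
  have /set2P u1 : u.1 \in [set v.1; v.2] by rewrite -Euv set21.
  have /set2P u2 : u.2 \in [set v.1; v.2] by rewrite -Euv set22.
  move: ltu; rewrite /g.
  by case: u1 => ->; case: u2 => -> //=; rewrite ?ltnn // ltnNge (ltnW ltv).
apply/andP; split.
  apply/forall_inP => B /imsetP[u]; rewrite inE => /andP[ltu].
  case/existsP=> e /andP[Ge /eqP ue] ->.
  apply/and4P; split; rewrite -?card_gt0 ?cards1 //.
    by rewrite disjoints1 inE neq_ltn ltu.
  apply/subsetP => f; rewrite Eg -ue => /eqP fe.
  by rewrite (val_inj fe).
apply/eqP/setP => e; apply/idP/bigcupP => [Ge|[_ /imsetP[u Qu ->]]].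
  have /cards2P[x [y [xy exy]]] : #|val e| == 2 := valP e.
  wlog ltxy: x y xy exy / (x < y)%N => [th|].
    case: (ltngtP x y) => [lt|lt|/val_inj E]; first exact: (th x y).
      by apply: (th y x) => //; rewrite 1?eq_sym // setUC.
    by rewrite E eqxx in xy.
  exists (g (x, y)); last by rewrite Eg /= -exy eqxx.
  apply: imset_f; rewrite inE /Q ltxy /=; apply/existsP.
  by exists e; rewrite Ge exy eqxx.
move: Qu; rewrite inE Eg => /andP[_ /existsP[f /andP[Gf /eqP<-]]] /eqP ef.
by rewrite (val_inj ef).
Qed.

Lemma partition_weight_exists (G : graph) : exists w, partition_weight G w.
Proof.
have [F PF] := biclique_partition_exists G.
by exists (weight F); apply/existsP; exists F; rewrite PF eqxx.
Qed.

Lemma covering_weight_exists (G : graph) : exists w, covering_weight G w.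
Proof.
have [F /andP[CF _]] := biclique_partition_exists G.
by exists (weight F); apply/existsP; exists F; rewrite CF eqxx.
Qed.

Definition bc (G : graph) : nat := ex_minn (covering_weight_exists G).
Definition bp (G : graph) : nat := ex_minn (partition_weight_exists G).

End Graphs.

(* Loaded only now, since these files shadow the finite-set names of finset. *)
From mathcomp Require Import all_classical all_reals all_analysis.
Import numFieldNormedType.Exports.

Section RandomGraphs.
Variable R : realType.

(* probability mass functions of G(n,p) and G(n,m) *)
Definition Gnp (p : R) (n : nat) (G : graph n) : R :=
  \prod_(e : edge n) (if e \in G then p else 1 - p).

Definition Gnm (n m : nat) (G : graph n) : R :=
  if #|G| == m then (#|[set H : graph n | #|H| == m]|%:R)^-1 else 0.

Definition Pr (n : nat) (mu : graph n -> R) (A : {set graph n}) : R :=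
  \sum_(G in A) mu G.

(* X = (1 + o(1)) Y with probability 1 - o(1), where delta bounds the
   deterministic o(1); Y may itself depend on the random graph. *)
Definition sim_whp (mu X Y : forall n, graph n -> R) : Prop :=
  exists delta : nat -> R,
    (delta n @[n --> \oo] --> (0 : R))%classic /\
    (Pr (mu n) [set G | (`|X n G - Y n G| <= delta n * `|Y n G|)%R]%SET
       @[n --> \oo] --> (1 : R))%classic.

Definition lg (x : R) : R := ln x / ln 2.

Definition h2 (x : R) : R := - x * lg x - (1 - x) * lg (1 - x).

End RandomGraphs.

(* Main.v *)
Require Import Defs.
From HB Require Import structures.
From mathcomp Require Import all_boot all_order all_algebra.
From mathcomp Require Import zify ring lra.

Set Implicit Arguments.
Unset Strict Implicit.
Unset Printing Implicit Defensive.

(** Both graph models give the same upper bound on bp and lower bound on bc,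
    and bc <= bp, so the two quantities agree up to a factor 1 + o(1).

    Lower bound.  A covering of weight w can be written as a word of w vertices,
    each marked with its side and with whether it opens a new biclique.  Hence
    at most (4 n)^w graphs have a covering of weight w ([card_small_bc]).  For w
    equal to 1 - eps times the claimed value, this number is
    exp ((1 - eps + o(1)) H C(n, 2)), where H is the entropy of p in nats,
    whereas outside an event of probability o(1) every single graph has
    probability at most exp (- (H - o(1)) C(n, 2)) ([bc_tail]).

    Upper bound.  Cut the vertices into consecutive blocks of s vertices, with s
    slightly below ln n / H.  For a block V and a subset S of V, the vertices
    after V whose neighbourhood in V is exactly S form a biclique with S, and
    all these bicliques are edge-disjoint.  A vertex is counted once for each
    earlier block, about n^2 / (2 s) times in total, which is the main term.
    The sides S are negligible as long as they range over the typical subsets of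
    V, since there are at most exp (s (H + eta)) <= n^(1 - eta) of these
    ([card_typical]).  If the neighbourhood of a vertex v in V is atypical, then
    V is subdivided, for v only, into K blocks of t = s / K vertices; here K is
    a constant so large that all 2^t subsets of a small block are affordable.
    Such a pair (v, V) costs at most K instead of 1, so all that is needed is
    that a pair is atypical with probability o(1).  This follows from
    Chebyshev's inequality ([deviation_hits]), so that the upper bound depends
    on the random graph only through its one-edge and two-edge probabilities.

    What both models have in common is isolated in [near_binomial].  Logarithms
    are natural in the proofs: h2 p / lg n is [entropy p] / ln n. *)

(** * Partitions from labellings *)

Lemma bp_le_weight n (G : graph n) F : biclique_partition G F -> bp G <= weight F.
Proof.
move=> PF; rewrite /bp; case: ex_minnP => m _; apply.
by apply/existsP; exists F; rewrite PF eqxx.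
Qed.

Lemma bc_le_bp n (G : graph n) : bc G <= bp G.
Proof.
rewrite /bp; case: ex_minnP => m /existsP[F /andP[/andP[CF _] wF]] _.
rewrite /bc; case: ex_minnP => k _; apply.
by apply/existsP; exists F; rewrite CF wF.
Qed.

Section Adjacency.
Variables (n : nat) (G : graph n).

Definition adj (u v : 'I_n) : bool := [exists e in G, val e == [set u; v]].

Lemma adjE (e : edge n) u v : val e = [set u; v] -> adj u v = (e \in G).
Proof.
move=> euv; apply/exists_inP/idP => [[f fG /eqP fuv]|eG].
  by have -> : e = f by apply: val_inj; rewrite euv fuv.
by exists e; rewrite ?euv.
Qed.

Lemma edge_ltP (e : edge n) : exists u v : 'I_n, u < v /\ val e = [set u; v].
Proof.
have /cards2P[x [y [xy exy]]] : #|val e| == 2 := valP e.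
case: (ltngtP x y) => [lt|lt|/val_inj E]; first by exists x, y.
  by exists y, x; rewrite setUC.
by rewrite E eqxx in xy.
Qed.

Lemma eq_edge_lt (u v x y : 'I_n) :
  u < v -> x < y -> [set u; v] = [set x; y] -> u = x /\ v = y.
Proof.
move=> uv xy E.
have : u \in [set x; y] by rewrite -E set21.
have : v \in [set x; y] by rewrite -E set22.
move=> /set2P[] hv /set2P[] hu; subst => //; move: uv xy; rewrite ?ltnn //.
by move=> /ltnW; rewrite leqNgt => /negbTE->.
Qed.

(** Give each pair u < v a label c v u.  The edges from v down to its
    neighbours with label j form a star; merging the stars with the same label
    and the same set of leaves S gives a biclique with sides S and the set of
    their centres.  An edge lies in exactly one star, so these bicliques
    partition the edge set whatever the labelling is. *)
Section Labelling.
Variables (J : finType) (c : 'I_n -> 'I_n -> J).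

Definition earlier_nbrs (v : 'I_n) (j : J) : {set 'I_n} :=
  [set u : 'I_n | [&& u < v, adj u v & c v u == j]].

Definition same_nbrs (j : J) (S : {set 'I_n}) : {set 'I_n} :=
  [set v | earlier_nbrs v j == S].

Definition label_parts (jS : J * {set 'I_n}) : parts n :=
  (jS.2, same_nbrs jS.1 jS.2).

Definition label_index : {set J * {set 'I_n}} :=
  [set jS | (jS.2 != set0) && (same_nbrs jS.1 jS.2 != set0)].

Definition label_family : {set parts n} := [set label_parts jS | jS in label_index].

Lemma same_nbrsP j (S : {set 'I_n}) u v : u \in S -> v \in same_nbrs j S ->
  [/\ u < v, adj u v, c v u = j & earlier_nbrs v j = S].
Proof.
move=> uS; rewrite inE => /eqP E; move: uS; rewrite -E inE.
by case/and3P=> ? ? /eqP.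
Qed.

Lemma mem_bicliqueE (B : parts n) (e : edge n) :
  reflect (exists x y, [/\ x \in B.1, y \in B.2 & val e = [set x; y]])
          (e \in bicliqueE B).
Proof.
rewrite inE; apply: (iffP exists_inP) => [[x xB /exists_inP[y yB /eqP E]]|].
  by exists x, y.
by case=> x [y [xB yB E]]; exists x => //; apply/exists_inP; exists y; rewrite ?E.
Qed.

Lemma label_family_partition : biclique_partition G label_family.
Proof.
apply/andP; split; last first.
  apply/forall_inP => B /imsetP[[j S] _ {B}->].
  apply/forall_inP => B /imsetP[[k T] _ {B}->].
  apply/implyP; apply: contraNT => /pred0Pn[e /andP[/=]].
  move=> /mem_bicliqueE[u [v [/= uS vS E]]] /mem_bicliqueE[x [y [/= xT yT E']]].
  have [uv _ cj fj] := same_nbrsP uS vS.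
  have [xy _ ck fk] := same_nbrsP xT yT.
  have [ux vy] := eq_edge_lt uv xy (etrans (esym E) E'); subst x y.
  by subst j k S T.
apply/andP; split.
  apply/forall_inP => B /imsetP[[j S]]; rewrite inE /= => /andP[S0 C0] {B}->.
  apply/and4P; split=> //=.
    rewrite -setI_eq0; apply/eqP/setP => x; rewrite !inE.
    by apply/negP => /andP[xS xC]; have [] := @same_nbrsP j S x x; rewrite ?inE ?ltnn.
  apply/subsetP => e /mem_bicliqueE[u [v [/= uS vS E]]].
  by have [_ + _ _] := same_nbrsP uS vS; rewrite (adjE E).
apply/eqP/setP => e; apply/idP/bigcupP => [eG|[_ /imsetP[[j S] _ ->]]].
  have [u [v [uv E]]] := edge_ltP e.
  have uF : u \in earlier_nbrs v (c v u) by rewrite inE uv (adjE E) eG eqxx.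
  exists (label_parts (c v u, earlier_nbrs v (c v u))).
    apply: imset_f; rewrite inE /=; apply/andP; split; apply/set0Pn.
      by exists u.
    by exists v; rewrite inE.
  by apply/mem_bicliqueE; exists u, v; split=> //=; rewrite inE.
move=> /mem_bicliqueE[u [v [/= uS vS E]]].
by have [_ + _ _] := same_nbrsP uS vS; rewrite (adjE E).
Qed.

Lemma leq_sum_imset (I T : finType) (h : I -> T) (A : {set I}) (F : T -> nat) :
  \sum_(x in h @: A) F x <= \sum_(i in A) F (h i).
Proof.
rewrite [leqRHS](partition_big_imset h) /=; apply: leq_sum => x /imsetP[i iA ->].
by rewrite (bigD1 i) ?iA ?eqxx //= leq_addr.
Qed.

(** The centres contribute one unit for each nonempty star, whereas each set of
    leaves is paid for only once per label, however many stars share it. *)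
Lemma bp_le_labelling :
  bp G <= \sum_j (#|[set v | earlier_nbrs v j != set0]|
                  + \sum_(S in [set earlier_nbrs v j | v : 'I_n]) #|S|).
Proof.
apply: leq_trans (bp_le_weight label_family_partition) _.
rewrite /weight /label_family; apply: leq_trans (leq_sum_imset _ _ _) _.
have wB jS : #|bicliqueV (label_parts jS)| <= #|same_nbrs jS.1 jS.2| + #|jS.2|.
  by rewrite addnC cardsU leq_subr.
apply: leq_trans; first by apply: leq_sum => jS _; exact: wB.
rewrite (eq_bigl (fun jS : J * {set 'I_n} => xpredT jS.1 &&
  ((jS.2 != set0) && (same_nbrs jS.1 jS.2 != set0)))); last by move=> ?; rewrite inE.
rewrite -(pair_big_dep xpredT (fun j S => (S != set0) && (same_nbrs j S != set0))
   (fun j S => #|same_nbrs j S| + #|S|)) /=.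
apply: leq_sum => j _; rewrite big_split leq_add //=.
  have -> : #|[set v | earlier_nbrs v j != set0]| =
     \sum_(S | (S != set0) && (same_nbrs j S != set0)) #|[set v in [set v | earlier_nbrs v j != set0] | earlier_nbrs v j == S]|.
    rewrite -sum1_card (partition_big (earlier_nbrs^~ j) (fun S => (S != set0) && (same_nbrs j S != set0))) /=.
      apply: eq_bigr => S _; rewrite -sum1_card; apply: eq_bigl => v.
      by rewrite !inE.
    move=> v; rewrite inE => -> /=; apply/set0Pn; exists v; by rewrite inE.
  apply: leq_sum => S /andP[S0 _]; apply: subset_leq_card; apply/subsetP => v.
  by rewrite !inE => /eqP->; rewrite S0 eqxx.
rewrite big_mkcond [leqRHS]big_mkcond; apply: leq_sum => S _.
case: ifP => // /andP[_ /set0Pn[v]]; rewrite inE => /eqP fS.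
by rewrite ifT //; apply/imsetP; exists v.
Qed.

End Labelling.
End Adjacency.

(** * Two scales of blocks *)

Section IntervalBlocks.
Variables (n d : nat).

Definition block (i : nat) : {set 'I_n} := [set u : 'I_n | u %/ d == i].

Lemma card_block_le i : 0 < d -> #|block i| <= d.
Proof.
move=> d0; pose h (u : 'I_n) : 'I_d := Ordinal (ltn_pmod u d0).
rewrite -[leqRHS]card_ord; apply: (@leq_card_in _ _ h) => u v.
rewrite !inE => /eqP ui /eqP vi [E]; apply: val_inj => /=.
by rewrite (divn_eq u d) (divn_eq v d) ui vi E.
Qed.

Lemma card_block i : 0 < d -> i.+1 * d <= n -> #|block i| = d.
Proof.
move=> d0 id; have hP (j : 'I_d) : i * d + j < n.
  by apply: leq_trans id; rewrite mulSn addnC ltn_add2r.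
pose h j := Ordinal (hP j).
have h_inj : injective h by move=> j k [/addnI/val_inj].
rewrite -[RHS]card_ord -(card_imset _ h_inj); apply: eq_card => u.
rewrite inE; apply/eqP/imsetP => [ui|[j _ ->]] /=; last first.
  by rewrite divnMDl ?(leq_ltn_trans _ (ltn_ord j)) // divn_small ?addn0.
exists (Ordinal (ltn_pmod u d0)) => //; apply: val_inj => /=.
by rewrite -ui -divn_eq.
Qed.

Lemma sum_card_block : \sum_(i < n) #|block i| <= n.
Proof.
rewrite -[leqRHS]card_ord -sum1_card.
have q_lt (u : 'I_n) : u %/ d < n by rewrite (leq_ltn_trans (leq_div _ _)).
rewrite [leqRHS](partition_big (fun u => Ordinal (q_lt u)) xpredT) //=.
by apply: leq_sum => i _; rewrite -sum1_card; apply/eq_leq/eq_bigl => u; rewrite inE.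
Qed.

End IntervalBlocks.

Lemma sum_card_le (T : finType) (V : {set T}) (P : {set {set T}}) :
  (forall S, S \in P -> S \subset V) -> \sum_(S in P) #|S| <= #|V| * #|P|.
Proof.
move=> sub; rewrite mulnC -sum_nat_const.
by apply: leq_sum => S /sub; exact: subset_leq_card.
Qed.

Lemma block_index_lt n d (u : 'I_n) : u %/ d < n.
Proof. by rewrite (leq_ltn_trans (leq_div _ _)). Qed.

Lemma card_lt_divn n d :
  #|[set vi : 'I_n * 'I_n | vi.2 < vi.1 %/ d]| <= \sum_(v < n) v %/ d.
Proof.
have -> : #|[set vi : 'I_n * 'I_n | vi.2 < vi.1 %/ d]| = \sum_(v < n) #|[set i : 'I_n | i < v %/ d]|.
  rewrite -sum1_card; under [RHS]eq_bigr => v _ do rewrite -sum1_card.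
  by rewrite pair_big_dep; apply: eq_bigl => -[v i]; rewrite !inE.
apply: leq_sum => v _.
have le_n : v %/ d <= n by rewrite ltnW // block_index_lt.
apply: (@leq_trans #|[set widen_ord le_n j | j in 'I_(v %/ d)]|); last first.
  by rewrite (leq_trans (leq_imset_card _ _)) // card_ord.
apply: subset_leq_card; apply/subsetP => i; rewrite inE => iv.
by apply/imsetP; exists (Ordinal iv) => //; apply: val_inj.
Qed.

Section TypicalLabels.
Variables (n : nat) (G : graph n) (t K : nat) (typ : pred nat).
Hypotheses (t0 : 0 < t) (K0 : 0 < K).
Let s := K * t.

Definition block_nbrs (v : 'I_n) (i : nat) : {set 'I_n} :=
  [set u in block n s i | adj G u v].

Definition atypical : {set 'I_n * 'I_n} :=
  [set vi : 'I_n * 'I_n | (vi.2 < vi.1 %/ s) && ~~ typ #|block_nbrs vi.1 vi.2|].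

(** An edge between v and an earlier block of length s is labelled by that block
    if v has a typical neighbourhood there.  The other edges, which include
    those inside a block, are labelled by the short block of the lower end. *)
Definition block_label (v u : 'I_n) : bool * 'I_n :=
  if (u %/ s < v %/ s) && typ #|block_nbrs v (u %/ s)|
  then (true, Ordinal (block_index_lt s u))
  else (false, Ordinal (block_index_lt t u)).

Let s0 : 0 < s. Proof. by rewrite muln_gt0 K0. Qed.

Lemma typical_label_nbrs v (i : 'I_n) : earlier_nbrs G block_label v (true, i) != set0 ->
  [/\ i < v %/ s, typ #|block_nbrs v i| & earlier_nbrs G block_label v (true, i) = block_nbrs v i].
Proof.
case/set0Pn => u; rewrite inE /block_label => /and3P[uv a].
case: ifP => // /andP[iv ty] /eqP[E]; have Ei : u %/ s = i by rewrite -E.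
rewrite Ei in iv ty; split=> //; apply/setP => w; rewrite !inE.
apply/and3P/andP => [[wv aw]|[/eqP wi aw]].
  by case: ifP => // _ /eqP[<-] /=.
split=> //; last by rewrite ifT ?wi ?iv //; apply/eqP; congr pair; exact: val_inj.
by rewrite ltnNge; apply: contraL iv => /(leq_div2r s); rewrite wi leqNgt.
Qed.

Lemma atypical_label_nbrs v (k : 'I_n) u : u \in earlier_nbrs G block_label v (false, k) ->
  u %/ t = k /\ (k %/ K = v %/ s \/
    k %/ K < v %/ s /\ ~~ typ #|block_nbrs v (k %/ K)|).
Proof.
rewrite inE /block_label => /and3P[uv a].
case: ifP => // + /eqP[<-] /=; rewrite -divnMA mulnC -/s => /negbT.
rewrite negb_and -leqNgt leq_eqVlt => h; split=> //.
have le : u %/ s <= v %/ s by rewrite leq_div2r // ltnW.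
case/orP: h => [/orP[/eqP->|]|nt]; [by left|by lia|].
case: (ltngtP (u %/ s) (v %/ s)) le => // [lt|->] _; last by left.
by right.
Qed.

(** A long block contains K short ones. *)
Lemma card_preim_divn (A : {set 'I_n * 'I_n}) :
  #|[set vk : 'I_n * 'I_n | (vk.1, Ordinal (block_index_lt K vk.2)) \in A]|
    <= K * #|A|.
Proof.
rewrite mulnC -sum1_card (partition_big
  (fun vk : 'I_n * 'I_n => (vk.1, Ordinal (block_index_lt K vk.2)))
  (fun vi => vi \in A)) /=; last first.
  by move=> vk; rewrite inE.
rewrite -sum_nat_const; apply: leq_sum => -[v i] _; rewrite sum1_card.
apply: leq_trans (card_block_le n i K0).
rewrite -(card_imset (mem (block n K i)) (can_inj (fun x => erefl : (v, x).2 = x))).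
apply: subset_leq_card; apply/subsetP => -[w k]; rewrite unfold_in /=.
by case/andP=> _ /eqP[-> ki]; apply: imset_f; rewrite inE -ki.
Qed.

(** The terms bound, in this order, the stars towards long blocks, the typical
    sets of leaves, the stars towards short blocks, and the subsets of short
    blocks.  The isolated n inside the third term accounts for the pairs formed
    by a vertex and its own block. *)
Lemma bp_le_blocks M :
  (forall V : {set 'I_n}, #|V| <= s ->
     #|[set S : {set 'I_n} | (S \subset V) && typ #|S|]| <= M) ->
  bp G <= \sum_(v < n) v %/ s + n * M + K * (#|atypical| + n) + n * 2 ^ t.
Proof.
move=> typM; apply: leq_trans (bp_le_labelling G block_label) _.
have sumJ (F : bool * 'I_n -> nat) :
    \sum_j F j = \sum_i F (true, i) + \sum_i F (false, i).
  by rewrite -(big_bool _ (fun b => \sum_i F (b, i))) pair_bigA; apply: eq_bigr => -[].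
have cardF (b : bool) : \sum_i #|[set v | earlier_nbrs G block_label v (b, i) != set0]| =
    #|[set vi : 'I_n * 'I_n | earlier_nbrs G block_label vi.1 (b, vi.2) != set0]|.
  rewrite -sum1_card; under eq_bigr => i _ do rewrite -sum1_card big_mkcond.
  rewrite exchange_big pair_bigA [RHS]big_mkcond; apply: eq_bigr => -[v i] _ /=.
  by rewrite !inE.
rewrite big_split /= !{}sumJ !{}cardF.
have bound1 : #|[set vi : 'I_n * 'I_n | earlier_nbrs G block_label vi.1 (true, vi.2) != set0]|
    <= \sum_(v < n) v %/ s.
  pose A := [set vi : 'I_n * 'I_n | vi.2 < vi.1 %/ s].
  apply: (@leq_trans #|A|).
    by apply/subset_leq_card/subsetP => -[v i]; rewrite !inE => /typical_label_nbrs[].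
  exact: card_lt_divn.
have bound2 : #|[set vi : 'I_n * 'I_n | earlier_nbrs G block_label vi.1 (false, vi.2) != set0]|
    <= K * (#|atypical| + n).
  pose D := [set (v, Ordinal (block_index_lt s v)) | v in 'I_n].
  apply: (@leq_trans (K * #|atypical :|: D|)); last first.
    rewrite leq_mul2l (leq_trans (leq_card_setU _ _)) ?orbT // leq_add2l.
    by rewrite (leq_trans (leq_imset_card _ _)) // card_ord.
  apply: leq_trans (card_preim_divn _); apply: subset_leq_card.
  apply/subsetP => -[v k]; rewrite !inE /= => /set0Pn[u /atypical_label_nbrs[_ [E|[lt nt]]]].
    apply/orP; right; apply/imsetP; exists v => //; congr pair; exact: val_inj.
  by rewrite lt nt.
have bound3 (F : 'I_n -> {set {set 'I_n}}) d N :
    (forall i S, S \in F i -> S \subset block n d i) ->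
    (forall i, #|[set S in F i | S != set0]| <= N) ->
    \sum_i \sum_(S in F i) #|S| <= n * N.
  move=> sub leN; apply: (@leq_trans (\sum_(i < n) #|block n d i| * N)); last first.
    by rewrite -big_distrl leq_mul2r sum_card_block orbT.
  apply: leq_sum => i _; apply: (@leq_trans (#|block n d i| * #|[set S in F i | S != set0]|)).
    apply: leq_trans (sum_card_le _); last by move=> S; rewrite inE => /andP[/sub].
    rewrite big_mkcond [leqRHS]big_mkcond; apply: leq_sum => S _; rewrite inE.
    by case: eqP => [->|]; rewrite ?cards0 ?andbT //= ; case: ifP.
  by rewrite leq_mul2l leN orbT.
have bound4 : \sum_(i < n) \sum_(S in [set earlier_nbrs G block_label v (true, i) | v : 'I_n]) #|S|
    <= n * M.
  apply: (bound3 _ s) => [i _ /imsetP[v _ ->]|i].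
    case: (eqVneq (earlier_nbrs G block_label v (true, i)) set0) => [->|/typical_label_nbrs[_ _ ->]].
      exact: sub0set.
    by apply/subsetP => u; rewrite inE => /andP[].
  apply: leq_trans (typM (block n s i) (card_block_le _ _ s0)); apply: subset_leq_card.
  apply/subsetP => S; rewrite inE => /andP[/imsetP[v _ ->] /typical_label_nbrs[_ ty ->]].
  by rewrite inE ty andbT; apply/subsetP => u; rewrite inE => /andP[].
have bound5 : \sum_(i < n) \sum_(S in [set earlier_nbrs G block_label v (false, i) | v : 'I_n]) #|S|
    <= n * 2 ^ t.
  apply: (bound3 _ t) => [i _ /imsetP[v _ ->]|i].
    by apply/subsetP => u /atypical_label_nbrs[E _]; rewrite inE E.
  apply: (@leq_trans #|powerset (block n t i)|); last first.
    by rewrite card_powerset leq_pexp2l // card_block_le.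
  apply: subset_leq_card; apply/subsetP => S; rewrite inE => /andP[/imsetP[v _ ->] _].
  by rewrite inE; apply/subsetP => u /atypical_label_nbrs[E _]; rewrite inE E.
by rewrite addnACA -!addnA !leq_add.
Qed.

End TypicalLabels.

(** * Counting graphs with light coverings *)

Section CoveringCodes.
Variable n : nat.

(** A vertex, the flag of its side (true for the first one), and the flag
    telling that the vertex opens a new biclique. *)
Definition token : finType := ('I_n * (bool * bool))%type.

(** A word is decoded from right to left: the biclique under construction is at
    the head of the list. *)
Definition push (k : token) (L : seq (parts n)) : seq (parts n) :=
  let: (v, (side, fresh)) := k in
  let B := if fresh then (set0, set0) else head (set0, set0) L in
  (if side then (v |: B.1, B.2) else (B.1, v |: B.2))
    :: if fresh then L else behead L.

Definition decode (l : seq token) : seq (parts n) := foldr push [::] l.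

Definition union_graph (L : seq (parts n)) : graph n := \bigcup_(B <- L) bicliqueE B.

Lemma push_side side (xs : seq 'I_n) (B : parts n) L :
  foldr push (B :: L) [seq (x, (side, false)) | x <- xs] =
  (if side then ([set:: xs] :|: B.1, B.2) else (B.1, [set:: xs] :|: B.2)) :: L.
Proof.
elim: xs => [|x xs IH] /=.
  by case: B side => X Y [] /=; congr (pair _ _ :: _); apply/setP => z; rewrite !inE.
by rewrite IH; case: side {IH} => /=; congr (pair _ _ :: _); rewrite set_cons setUA.
Qed.

Lemma biclique_code (B : parts n) : B.2 != set0 ->
  exists2 l : seq token, size l = #|B.1| + #|B.2| & forall L, foldr push L l = B :: L.
Proof.
case: B => X Y /= /set0Pn[y yY].
exists ([seq (x, (true, false)) | x <- enum X] ++
        ([seq (x, (false, false)) | x <- enum (Y :\ y)] ++ [:: (y, (false, true))])).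
  by rewrite !size_cat !size_map -!cardE /= addn1 (cardsD1 y Y) yY.
move=> L; rewrite !foldr_cat /= !push_side /= !set_enum !setU0.
by rewrite setUC setD1K.
Qed.

Lemma family_code (L : seq (parts n)) : {in L, forall B, B.2 != set0} ->
  exists2 l : seq token, size l = \sum_(B <- L) (#|B.1| + #|B.2|) & decode l = L.
Proof.
elim: L => [|B L IH] ne; first by exists [::]; rewrite ?big_nil.
have [l szl decl] := IH (fun C CL => ne C (@mem_behead _ (B :: L) C CL)).
have [b szb pushb] := biclique_code (ne B (mem_head _ _)).
exists (b ++ l); first by rewrite size_cat szl szb big_cons.
by rewrite /decode foldr_cat -/(decode l) decl pushb.
Qed.

(** A biclique with an empty side has no edges, so that one-vertex bicliques may
    be used to lengthen a code without changing its graph. *)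
Lemma union_graph_pad v k L :
  union_graph (foldr push L (nseq k (v, (true, true)))) = union_graph L.
Proof.
elim: k => //= k IH; rewrite /union_graph big_cons -/(union_graph _) IH setU0.
apply/setUidPr/subsetP => e /mem_bicliqueE[x [y [_ /=]]]; by rewrite inE.
Qed.


End CoveringCodes.

Lemma covering_code n (G : graph n) w : 0 < n -> bc G <= w ->
  exists2 l : seq (token n), size l = w & union_graph (decode l) = G.
Proof.
case: n G => // n G _; rewrite /bc; case: ex_minnP => b.
case/existsP=> F /andP[/andP[/forall_inP bF /eqP GF] /eqP <-] _ wF.
have ne : {in enum F, forall B, B.2 != set0}.
  by move=> B; rewrite mem_enum => /bF/and4P[].
have [l szl decl] := family_code ne.
have szF : size l = weight F.
  rewrite szl /weight big_enum; apply: eq_bigr => B BF.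
  rewrite cardsU; have [_ _ /disjoint_setI0 -> _] := and4P (bF B BF).
  by rewrite cards0 subn0.
exists (nseq (w - size l) (ord0, (true, true)) ++ l).
  by rewrite size_cat size_nseq subnK // szF.
rewrite /decode foldr_cat union_graph_pad -/(decode l) decl /union_graph.
by rewrite big_enum -GF.
Qed.

Lemma card_small_bc n w : 0 < n -> #|[set G : graph n | bc G <= w]| <= (4 * n) ^ w.
Proof.
move=> n0.
apply: (@leq_trans #|[set union_graph (decode l) | l : w.-tuple (token n)]|).
  apply: subset_leq_card; apply/subsetP => G; rewrite inE => /(covering_code n0)[l szl <-].
  by apply/imsetP; exists (Tuple (introT eqP szl)).
rewrite (leq_trans (leq_imset_card _ _)) // card_tuple.
by rewrite !card_prod card_bool card_ord mulnC.
Qed.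

(** * The mode of the binomial distribution and supersets of given size *)

(** These are the binomial probabilities with parameter m / N, multiplied by
    N ^ N: they increase up to m and decrease afterwards. *)
Lemma binomial_term_le_mode N m k : m <= N -> k <= N ->
  'C(N, k) * (m ^ k * (N - m) ^ (N - k)) <= 'C(N, m) * (m ^ m * (N - m) ^ (N - m)).
Proof.
move=> mN; pose a k := 'C(N, k) * (m ^ k * (N - m) ^ (N - k)); rewrite -/(a k) -/(a m).
have step j : j < N -> a j.+1 * (j.+1 * (N - m)) = a j * ((N - j) * m).
  move=> jN; have := mul_bin_left N j; rewrite /a.
  have -> : N - j = (N - j.+1).+1 by lia.
  set r := N - j.+1; set d := N - m; set c1 := 'C(N, j.+1); set c0 := 'C(N, j) => E.
  transitivity ((j.+1 * c1) * (m ^ j.+1 * d ^ r * d)); first by lia.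
  by rewrite E !expnS; lia.
have up j : m <= m + j -> m + j <= N -> a (m + j) <= a m.
  elim: j => [|j IH _ jN]; first by rewrite addn0.
  apply: leq_trans (IH _ _); [|lia..]; rewrite addnS.
  have S : m + j < N by lia.
  have M0 : 0 < (m + j).+1 * (N - m) by nia.
  rewrite -(leq_pmul2r M0) step // leq_mul2l; apply/orP; right; nia.
have down j : j <= m -> a (m - j) <= a m.
  elim: j => [|j IH jm]; first by rewrite subn0.
  apply: leq_trans (IH _); last by lia.
  have -> : m - j = (m - j.+1).+1 by lia.
  have := step (m - j.+1); set i := m - j.+1 => st.
  have [m_lt|m_ge] := ltnP m N; last first.
    have E : N - m = 0 by lia.
    by rewrite /a E exp0n ?muln0 //; lia.
  have M0 : 0 < (N - i) * m by nia.
  rewrite -(leq_pmul2r M0) -st; last by lia.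
  rewrite leq_mul2l; apply/orP; right; nia.
move=> kN; have [mk|/ltnW km] := leqP m k.
  by rewrite -(subnKC mk) up //; lia.
by rewrite -(subKn km) down //; lia.
Qed.

(** The N + 1 binomial probabilities add up to 1, so the largest one is at
    least 1 / (N + 1). *)
Lemma expn_le_mode N m : m <= N ->
  N ^ N <= N.+1 * ('C(N, m) * (m ^ m * (N - m) ^ (N - m))).
Proof.
move=> mN; rewrite -{1}(subnK mN) expnDn -[X in _ <= X * _]card_ord -sum_nat_const.
apply: leq_sum => k _; rewrite (mulnC ((N - m) ^ _)).
exact: (binomial_term_le_mode mN (leq_ord k)).
Qed.

Section SupersetCount.
Variable T : finType.

Lemma card_supersets (B : {set T}) k :
  #|[set G : {set T} | (B \subset G) && (#|G| == #|B| + k)]| = 'C(#|T| - #|B|, k).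
Proof.
rewrite (_ : #|T| - #|B| = #|~: B|); last by rewrite [RHS]cardsCs setCK.
rewrite -cards_draws.
transitivity #|[set A :|: B | A in [set A : {set T} | (A \subset ~: B) && (#|A| == k)]]|;
  last first.
  apply: card_in_imset => A1 A2; rewrite !inE => /andP[s1 _] /andP[s2 _] E.
  have D (A : {set T}) : A \subset ~: B -> (A :|: B) :\: B = A.
    rewrite -disjoints_subset setDUl setDv setU0 => /setDidPl; exact.
  by rewrite -(D _ s1) -(D _ s2) E.
apply: eq_card => G; rewrite inE; apply/andP/imsetP => [[BG /eqP cG]|[A + ->]].
  exists (G :\: B); last first.
    apply/setP => x; rewrite !inE; case: (boolP (x \in B)) => [/(subsetP BG)->|_] //.
    by rewrite orbF.
  rewrite inE setDE subsetIr -setDE cardsD (setIidPr BG) cG addKn eqxx.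
  by [].
rewrite inE => /andP[AB /eqP cA]; rewrite subsetUr cardsU cA.
by move: AB; rewrite -disjoints_subset => /disjoint_setI0 ->; rewrite cards0 subn0 addnC.
Qed.

Lemma card_supersets1 (x : T) m :
  #|[set G : {set T} | (x \in G) && (#|G| == m)]| * #|T| = m * 'C(#|T|, m).
Proof.
case: m => [|m].
  rewrite mul0n; apply/eqP; rewrite muln_eq0 cards_eq0; apply/orP; left.
  by apply/eqP/setP => G; rewrite !inE cards_eq0; apply/negP => /andP[xG /eqP E]; rewrite E inE in xG.
have -> : [set G : {set T} | (x \in G) && (#|G| == m.+1)] =
    [set G : {set T} | ([set x] \subset G) && (#|G| == #|[set x]| + m)].
  by apply/setP => G; rewrite !inE sub1set cards1.
by rewrite card_supersets cards1 subn1 mulnC mul_bin_diag.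
Qed.

Lemma card_supersets2 (x y : T) m : x != y ->
  #|[set G : {set T} | [&& x \in G, y \in G & #|G| == m]]| * #|T| ^ 2 <= m ^ 2 * 'C(#|T|, m).
Proof.
move=> xy; have c2 : #|[set x; y]| = 2 by rewrite cards2 xy.
have T2 : 1 < #|T| by rewrite -c2 max_card.
case: m => [|[|m]].
- rewrite (_ : [set _ | _] = set0) ?cards0 //; apply/setP => G; rewrite !inE cards_eq0.
  by apply/negP => /and3P[xG _ /eqP E]; rewrite E inE in xG.
- rewrite (_ : [set _ | _] = set0) ?cards0 //; apply/setP => G; rewrite !inE.
  apply/negP => /and3P[xG yG /eqP E].
  suff : 2 <= #|G| by rewrite E.
  by rewrite -c2 subset_leq_card // subUset !sub1set xG.
have -> : [set G : {set T} | [&& x \in G, y \in G & #|G| == m.+2]] =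
    [set G : {set T} | ([set x; y] \subset G) && (#|G| == #|[set x; y]| + m)].
  by apply/setP => G; rewrite !inE subUset !sub1set c2 andbA.
rewrite card_supersets c2.
have [mT|Tm] := leqP m.+2 #|T|; last by rewrite bin_small ?mul0n //; lia.
have E1 := mul_bin_diag #|T| m.+1; have E2 := mul_bin_diag #|T|.-1 m.
have E3 : #|T|.-1.-1 = #|T| - 2 by lia.
rewrite E3 in E2; set c := 'C(_ - 2, m) in E2 *; set C := 'C(#|T|, m.+2) in E1 *.
set d := 'C(_, m.+1) in E1 E2; move: #|T| T2 mT E1 E2 => N N2 mN E1 E2.
have E : N * N.-1 * c = m.+2 * m.+1 * C by rewrite -mulnA E2 mulnCA E1; lia.
have P0 : 0 < N.-1 by lia.
rewrite -(leq_pmul2r P0).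
have -> : c * N ^ 2 * N.-1 = N * (N * N.-1 * c) by rewrite expnS expn1; lia.
rewrite E.
have -> : N * (m.+2 * m.+1 * C) = (m.+2 * C) * (N * m.+1) by lia.
have -> : m.+2 ^ 2 * C * N.-1 = (m.+2 * C) * (m.+2 * N.-1) by rewrite expnS expn1; lia.
rewrite leq_mul2l; apply/orP; right; nia.
Qed.

End SupersetCount.

Lemma card_edge n : #|{: edge n}| = 'C(n, 2).
Proof.
rewrite card_sig -[n in RHS]card_ord -card_draws.
by apply: eq_card => A; rewrite !inE.
Qed.

(* Loaded only now, since these files shadow the finite-set names of finset. *)
From mathcomp Require Import all_classical all_reals all_analysis.

Set Implicit Arguments.
Unset Strict Implicit.
Unset Printing Implicit Defensive.

Import Order.TTheory GRing.Theory Num.Theory.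
Import numFieldNormedType.Exports.

Local Open Scope ring_scope.

(** * Near-binomial random graphs *)

Section ProductWeights.
Variables (R : realType) (T : finType).
Implicit Types (a b : R) (S V : {set T}).

Lemma prod_setE a b S V : S \subset V ->
  \prod_(x in V) (if x \in S then a else b) = a ^+ #|S| * b ^+ (#|V| - #|S|).
Proof.
move=> SV; rewrite (big_setID S) /= (finset.setIidPr SV).
rewrite (eq_bigr (fun=> a)); last by move=> x ->.
rewrite [X in _ * X](eq_bigr (fun=> b)); last by move=> x /setDP[_ /negbTE->].
by rewrite !big_const !iter_mulr_1 cardsD (finset.setIidPr SV).
Qed.

End ProductWeights.

Section EdgeLaws.
Variable R : realType.

Lemma PrE n (mu : graph n -> R) (P : pred (graph n)) :
  Pr mu [set G | P G]%SET = \sum_(G | P G) mu G.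
Proof. by rewrite /Pr; apply: eq_bigl => G; rewrite inE. Qed.

Lemma GnpE p n (G : graph n) :
  Gnp p G = p ^+ #|G| * (1 - p) ^+ (#|{: edge n}| - #|G|) :> R.
Proof.
rewrite /Gnp -cardsT -prod_setE ?subsetT //.
by apply: eq_bigl => e; rewrite inE.
Qed.

Lemma Gnp_superset p n (B : {set edge n}) :
  \sum_(G : graph n | B \subset G) Gnp p G = p ^+ #|B| :> R.
Proof.
rewrite -prodr_const [RHS]big_mkcond /=.
transitivity (\prod_(e : edge n) (p + (if e \in B then 0 else 1 - p)) : R); last first.
  by apply: eq_bigr => e _; case: ifP; rewrite ?addr0 // subrKC.
rewrite bigA_distr big_mkcond /=; apply: eq_bigr => G _.
case: (boolP (B \subset G)) => [BG|].
  apply: eq_bigr => e _; case: ifP => // eG; case: ifP => // /(fintype.subsetP BG).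
  by rewrite eG.
by case/fintype.subsetPn => e eB eG; rewrite (bigD1 e) //= (negbTE eG) eB mul0r.
Qed.


(** What the proof needs to know about the random graph: up to a polynomial
    factor, no graph is more likely than in G(n, q), every edge has
    probability q, and distinct edges are not positively correlated. *)
Record near_binomial n (mu : graph n -> R) (q : R) : Prop := NearBinomial {
  nb_q : 0 <= q <= 1;
  nb_ge0 : forall G, 0 <= mu G;
  nb_sum : \sum_G mu G = 1;
  nb_le : forall G, mu G <=
    #|{: edge n}|.+1%:R * (q ^+ #|G| * (1 - q) ^+ (#|{: edge n}| - #|G|));
  nb_edge : forall e, \sum_(G : graph n | e \in G) mu G = q;
  nb_edge2 : forall e f, e != f ->
    \sum_(G : graph n | (e \in G) && (f \in G)) mu G <= q ^+ 2
}.

Lemma Gnp_near_binomial p n : 0 <= p <= 1 -> near_binomial (@Gnp R p n) p.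
Proof.
move=> /[dup] p01 /andP[p0 p1]; have w0 (G : graph n) :
    0 <= p ^+ #|G| * (1 - p) ^+ (#|{: edge n}| - #|G|).
  by rewrite mulr_ge0 // exprn_ge0 // subr_ge0.
split=> // [G||G|e|e f ef].
- by rewrite GnpE.
- have := Gnp_superset p (finset.set0 : {set edge n}); rewrite cards0 expr0 => <-.
  by apply: eq_bigl => G; rewrite finset.sub0set.
- by rewrite GnpE ler_peMl // ler1n.
- have := Gnp_superset p [set e]%SET; rewrite cards1 expr1 => E.
  by rewrite -[RHS]E; apply: eq_bigl => G; rewrite finset.sub1set.
- have := Gnp_superset p [set e; f]%SET; rewrite cards2 ef => E.
  rewrite -[leRHS]E; rewrite le_eqVlt; apply/orP; left; apply/eqP/eq_bigl => G.
  by rewrite finset.subUset !finset.sub1set.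
Qed.

(** A graph with m edges has probability q ^ m (1 - q) ^ (N - m) in G(n, q);
    since m is the mode of the number of edges when q = m / N, conditioning
    on having m edges multiplies this by at most N + 1. *)
Lemma Gnm_near_binomial n m : (0 < 'C(n, 2))%N -> (m <= 'C(n, 2))%N ->
  near_binomial (@Gnm R n m) (m%:R / 'C(n, 2)%:R).
Proof.
rewrite -card_edge; set N := #|{: edge n}| => N0 mN.
have NR0 : (0 : R) < N%:R by rewrite ltr0n.
set C : R := 'C(N, m)%:R; have C0 : 0 < C by rewrite ltr0n bin_gt0.
have cardm : #|[set H : graph n | #|H| == m]%SET| = 'C(N, m) by rewrite card_draws.
have sumP (P : pred (graph n)) : \sum_(G | P G) Gnm R m G =
    #|[set G : graph n | P G && (#|G| == m)]%SET|%:R / C.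
  rewrite /Gnm cardm -/C -big_mkcondr /= sumr_const mulr_natl; congr (_ *+ _).
  by apply: eq_card => G; rewrite inE.
split=> [|G||G|e|e f ef].
- by rewrite divr_ge0 ?ler0n //= ler_pdivrMr // mul1r ler_nat.
- by rewrite /Gnm; case: ifP; rewrite ?invr_ge0 ?ler0n.
- by rewrite sumP /= cardm divff // lt0r_neq0.
- rewrite /Gnm cardm -/N -/C; case: eqP => [->|_]; last first.
    have q1 : 0 <= 1 - m%:R / N%:R :> R.
      by rewrite subr_ge0 ler_pdivrMr // mul1r ler_nat.
    by rewrite !mulr_ge0 ?exprn_ge0 ?divr_ge0 ?ler0n.
  have -> : 1 - m%:R / N%:R = (N - m)%:R / N%:R :> R.
    by rewrite natrB // mulrBl divff // lt0r_neq0.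
  rewrite !expr_div_n mulrACA -invfM -exprD subnKC // -div1r ler_pdivrMr //.
  rewrite mulrA mulrAC ler_pdivlMr ?exprn_gt0 // mul1r.
  have := expn_le_mode mN; rewrite -(ler_nat R) !natrM !natrX -/C.
  by rewrite [C * _]mulrC !mulrA.
- rewrite sumP; apply/eqP; rewrite eqr_div ?lt0r_neq0 // -!natrM eqr_nat.
  by rewrite card_supersets1.
- rewrite sumP expr_div_n ler_pdivrMr // mulrAC ler_pdivlMr ?exprn_gt0 //.
  rewrite -!natrX -!natrM ler_nat.
  rewrite (_ : [set G : graph n | _]%SET =
      [set G : graph n | [&& e \in G, f \in G & #|G| == m]]%SET) ?card_supersets2 //.
  by apply/setP => G; rewrite !inE andbA.
Qed.

Section Concentration.
Variables (n : nat) (mu : graph n -> R) (q : R).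
Hypothesis mu_q : near_binomial mu q.

Definition hits (W : {set edge n}) (G : graph n) : R := #|(G :&: W)%SET|%:R.

Lemma hitsE W G : hits W G = \sum_(e in W) (e \in G)%:R.
Proof.
rewrite /hits -sum1_card natr_sum big_mkcond [RHS]big_mkcond /=.
by apply: eq_bigr => e _; rewrite inE; case: (e \in W); case: (e \in G).
Qed.

Lemma mean_hits W : \sum_G mu G * hits W G = #|W|%:R * q.
Proof.
under eq_bigr => G _ do rewrite hitsE mulr_sumr.
rewrite exchange_big /= mulr_natl -sumr_const; apply: eq_bigr => e _.
rewrite -(nb_edge mu_q e) [RHS]big_mkcond; apply: eq_bigr => G _ /=.
by case: ifP; rewrite ?mulr1 ?mulr0.
Qed.

(** The off-diagonal terms are at most q ^ 2 because distinct edges are not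
    positively correlated; the diagonal contributes the mean. *)
Lemma mean_sqr_hits W :
  \sum_G mu G * hits W G ^+ 2 <= #|W|%:R * q + (#|W|%:R * q) ^+ 2.
Proof.
have -> : \sum_G mu G * hits W G ^+ 2 =
    \sum_(e in W) \sum_(f in W) \sum_(G : graph n | (e \in G) && (f \in G)) mu G.
  transitivity (\sum_(G : graph n) \sum_(e in W) \sum_(f in W) if (e \in G) && (f \in G) then mu G else 0).
    apply: eq_bigr => G _; rewrite expr2 hitsE mulr_suml mulr_sumr.
    apply: eq_bigr => e _; rewrite !mulr_sumr; apply: eq_bigr => f _.
    by do 2!case: (_ \in G); rewrite /= ?mul1r ?mulr1 ?mulr0 ?mul0r ?mulr0.
  rewrite exchange_big; apply: eq_bigr => e _; rewrite exchange_big /=.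
  by apply: eq_bigr => f _; rewrite -big_mkcond.
have qq : 0 <= q ^+ 2 by rewrite sqr_ge0.
have -> : #|W|%:R * q + (#|W|%:R * q) ^+ 2 =
    \sum_(e in W) (q + \sum_(f in W) q ^+ 2).
  rewrite big_split /= !sumr_const -(mulr_natr q) -(mulr_natr (_ *+ _)) -(mulr_natr (q ^+ 2)).
  by rewrite mulrC exprMn_comm; [rewrite mulrC (expr2 #|W|%:R) mulrA | exact: mulrC].
apply: ler_sum => e eW; rewrite (bigD1 e) //=; apply: lerD.
  by rewrite -(nb_edge mu_q e) (eq_bigl (fun G : graph n => e \in G)) // => G; rewrite andbb.
rewrite [leRHS](bigD1 e) //=; apply: ler_wpDl => //.
by apply: ler_sum => f /andP[_ fe]; apply: (nb_edge2 mu_q); rewrite eq_sym.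
Qed.

(** Chebyshev's inequality.  The deviation is measured from p rather than from
    the edge density q, which costs the term (q - p) ^ 2, and the sign of
    [Lam] selects the tail. *)
Lemma deviation_hits (W : {set edge n}) (p eta Lam : R) : (0 < #|W|)%N -> 0 <= p -> 0 < eta ->
  Pr mu [set G | eta * #|W|%:R < (hits W G - p * #|W|%:R) * Lam]%SET <=
    (Lam / eta) ^+ 2 * (#|W|%:R^-1 + (q - p) ^+ 2).
Proof.
move=> W0 p0 eta0; have /andP[q0 q1] := nb_q mu_q.
rewrite PrE big_mkcond /=.
have s0 : (0 : R) < #|W|%:R by rewrite ltr0n.
have := mean_sqr_hits W; have := mean_hits W; move: (#|W|%:R) s0 => s s0 mean sqr.
pose Y G := ((hits W G - p * s) * Lam / (eta * s)) ^+ 2.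
apply: (@le_trans _ _ (\sum_G mu G * Y G)).
  apply: ler_sum => G _; case: ifP => [big|_]; last by rewrite mulr_ge0 ?sqr_ge0 ?(nb_ge0 mu_q).
  rewrite ler_peMr ?(nb_ge0 mu_q) // /Y exprn_ege1 // ler_pdivlMr ?mulr_gt0 //.
  by rewrite mul1r ltW.
have -> : \sum_G mu G * Y G = (Lam / (eta * s)) ^+ 2 *
    (\sum_G mu G * hits W G ^+ 2 - 2 * (p * s) * (\sum_G mu G * hits W G)
     + (p * s) ^+ 2 * \sum_G mu G).
  rewrite !mulr_sumr -sumrB -big_split /= mulr_sumr; apply: eq_bigr => G _.
  by rewrite /Y; ring.
rewrite mean (nb_sum mu_q) mulr1.
have -> : (Lam / eta) ^+ 2 * (s^-1 + (q - p) ^+ 2) =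
    (Lam / (eta * s)) ^+ 2 * (s + s ^+ 2 * (q - p) ^+ 2).
  by field; rewrite !gt_eqF.
rewrite ler_wpM2l ?sqr_ge0 //.
apply: (@le_trans _ _ (s * q + (s * q) ^+ 2 - 2 * (p * s) * (s * q) + (p * s) ^+ 2)).
  by rewrite !lerD2r.
have : s * q <= s by rewrite ler_piMr // ltW.
by move=> sq; nra.
Qed.

End Concentration.

End EdgeLaws.

(** * Entropy and typical sets *)

Section Entropy.
Variables (R : realType) (p : R).
Hypotheses (p_gt0 : 0 < p) (p_lt1 : p < 1).

Definition entropy : R := - p * ln p - (1 - p) * ln (1 - p).
Definition neg_logit : R := ln (1 - p) - ln p.

Let q_gt0 : 0 < 1 - p. Proof. by rewrite subr_gt0. Qed.

Lemma entropy_gt0 : 0 < entropy.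
Proof.
have lnp : ln p < 0 by apply: ln_lt0; rewrite p_gt0.
have lnq : ln (1 - p) < 0 by apply: ln_lt0; rewrite q_gt0 gtrBl.
have a : p * ln p < 0 by rewrite pmulr_rlt0.
have b : (1 - p) * ln (1 - p) < 0 by rewrite pmulr_rlt0.
by rewrite /entropy mulNr; lra.
Qed.

Lemma bernoulli_weightE k s : (k <= s)%N ->
  p ^+ k * (1 - p) ^+ (s - k) =
  expR (- (s%:R * entropy + (k%:R - p * s%:R) * neg_logit)).
Proof.
move=> ks; rewrite -{1}(lnK p_gt0) -{1}(lnK q_gt0) -!expRM_natl -expRD natrB //.
by congr expR; rewrite /entropy /neg_logit; ring.
Qed.

(** By [bernoulli_weightE], this says that a given k-subset of an s-set has
    Bernoulli probability at least exp (- s (H + eta)). *)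
Definition typical (eta : R) (s k : nat) : bool :=
  (k%:R - p * s%:R) * neg_logit <= eta * s%:R.

(** Each typical set has weight at least exp (- s (H + eta)) in a probability
    distribution on the subsets of V. *)
Lemma card_typical (eta : R) (T : finType) (V : {set T}) s : (#|V| <= s)%N ->
  #|[set S : {set T} | (S \subset V) && typical eta s #|S|]%SET|%:R <=
    expR (s%:R * (entropy + eta)).
Proof.
move=> Vs; set A := [set S | _]%SET.
have -> : expR (s%:R * (entropy + eta)) = (expR (- (s%:R * (entropy + eta))))^-1.
  by rewrite expRN invrK.
rewrite -[leRHS]div1r ler_pdivlMr ?expR_gt0 //.
(* w S vanishes unless S is a subset of V, so that all of {set T} can be summed. *)
pose w (S : {set T}) : R := \prod_x (if x \in S then if x \in V then p else 0
                             else if x \in V then 1 - p else 1).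
have w0 S : 0 <= w S.
  by apply: prodr_ge0 => x _; do 2!case: ifP => _ //; exact: ltW.
have sumw : \sum_(S : {set T}) w S = 1.
  rewrite -bigA_distr big1 // => x _.
  by case: (x \in V); rewrite /= ?add0r // subrKC.
rewrite [leLHS]mulr_natl -sumr_const -[leRHS]sumw [leLHS]big_mkcond /=; apply: ler_sum => S _.
case: ifP => //; rewrite inE => /andP[SV ty].
have -> : w S = p ^+ #|S| * (1 - p) ^+ (#|V| - #|S|).
  rewrite -prod_setE // [RHS]big_mkcond /=; apply: eq_bigr => x _.
  by case: (boolP (x \in S)) => [/(fintype.subsetP SV)->|].
have cS : (#|S| <= #|V|)%N by rewrite subset_leq_card.
apply: (@le_trans _ _ (p ^+ #|S| * (1 - p) ^+ (s - #|S|))); last first.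
  rewrite ler_wpM2l ?exprn_ge0 ?ler_wiXn2l //; [exact: ltW..| |].
  - by rewrite gerBl ltW.
  - by rewrite leq_sub2r.
rewrite bernoulli_weightE ?(leq_trans cS) // ler_expR lerN2.
move: ty; rewrite /typical; nra.
Qed.

End Entropy.

(** The neighbours of v in U correspond to the edges of the graph within a fixed
    set of |U| edges, to which [deviation_hits] applies. *)
Section StarEdges.
Variables (n : nat) (v : 'I_n) (U : {set 'I_n}).
Hypothesis vU : v \notin U.

Definition star : {set edge n} := [set e : edge n | [exists u in U, val e == [set u; v]%SET]]%SET.

Lemma card_star_adj (G : graph n) : #|(G :&: star)%SET| = #|[set u in U | adj G u v]%SET|.
Proof.
have inj_v : {in [set u in U | adj G u v]%SET &, injective (fun u => [set u; v]%SET)}.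
  move=> u w; rewrite !inE => /andP[uU _] /andP[wU _] /setP/(_ u).
  rewrite !inE eqxx /= => /esym/orP[/eqP//|/eqP E].
  by rewrite E (negbTE vU) in uU.
rewrite -(card_in_imset inj_v) -(card_imset _ val_inj); apply: eq_card => A.
apply/imsetP/imsetP => [[e]|[u]]; rewrite !inE.
  case/andP=> eG /exists_inP[u uU /eqP E] ->; exists u; rewrite // inE uU.
  by rewrite (adjE _ E).
case/andP=> uU /exists_inP[e eG /eqP E] ->; exists e; rewrite // !inE eG.
by apply/exists_inP; exists u; rewrite ?E.
Qed.

Lemma card_star : #|star| = #|U|.
Proof.
rewrite -(finset.setTI star) card_star_adj; apply: eq_card => u.
rewrite !inE; case: (boolP (u \in U)) => //= uU.
have uv : #|[set u; v]%SET| == 2%N.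
  by rewrite cards2; case: (eqVneq u v) uU => [->|//]; rewrite (negbTE vU).
by apply/exists_inP; exists (exist (fun e : {set 'I_n} => #|e| == 2%N) _ uv); rewrite ?inE /=.
Qed.

End StarEdges.

(** * Light partitions for a fixed number of vertices *)

Section FixedSize.
Variables (R : realType) (p : R).
Hypotheses (p_gt0 : 0 < p) (p_lt1 : p < 1).
Variables (n : nat) (mu : graph n -> R) (q : R).
Hypothesis mu_q : near_binomial mu q.

Lemma Pr_le (P Q : pred (graph n)) : (forall G, P G -> Q G) ->
  Pr mu [set G | P G]%SET <= Pr mu [set G | Q G]%SET.
Proof.
move=> PQ; rewrite !PrE [leLHS]big_mkcond [leRHS]big_mkcond /=.
apply: ler_sum => G _; case: ifP => [/PQ->//|_].
by case: ifP => // _; exact: nb_ge0 mu_q G.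
Qed.

Lemma markov (X : graph n -> R) x : (forall G, 0 <= X G) -> 0 < x ->
  Pr mu [set G | x < X G]%SET <= (\sum_G mu G * X G) / x.
Proof.
move=> X0 x0; rewrite PrE ler_pdivlMr // mulr_suml big_mkcond /=.
apply: ler_sum => G _; have m0 := nb_ge0 mu_q G; case: ifP => [/ltW h|_].
  by rewrite ler_wpM2l.
by rewrite mulr_ge0.
Qed.

Lemma sum_divn_le s : (0 < s)%N ->
  (\sum_(v < n) v %/ s)%N%:R <= n%:R ^+ 2 / (2 * s%:R) :> R.
Proof.
move=> s0; have sR : (0 : R) < s%:R by rewrite ltr0n.
rewrite ler_pdivlMr ?mulr_gt0 // mulrCA -!natrM -natrX ler_nat.
rewrite big_distrl /=; apply: (@leq_trans (2 * \sum_(v < n) v)).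
  by rewrite leq_mul2l /=; apply: leq_sum => v _; exact: leq_trunc_div.
rewrite mul2n -(big_mkord xpredT id) bin2_sum; have := bin2odd; rewrite bin2.
by have := leq_trunc_div (n * n.-1) 2; rewrite divn2 muln2; nia.
Qed.

Variables (t K : nat) (eta : R).
Hypotheses (t_gt0 : (0 < t)%N) (K_gt0 : (0 < K)%N) (eta_gt0 : 0 < eta).
Let s := (K * t)%N.

Let s_gt0 : (0 < s)%N. Proof. by rewrite muln_gt0 K_gt0. Qed.

(** The block i lies entirely before v, so it has exactly s vertices. *)
Lemma Pr_atypical (v i : 'I_n) : (i < v %/ s)%N ->
  Pr mu [set G | ~~ typical p eta s #|block_nbrs G t K v i|]%SET <=
    (neg_logit p / eta) ^+ 2 * (s%:R^-1 + (q - p) ^+ 2).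
Proof.
move=> iv; have vU : v \notin block n s i by rewrite inE neq_ltn iv orbT.
have cW : #|star v (block n s i)| = s.
  rewrite card_star // card_block // (leq_trans _ (ltnW (ltn_ord v))) //.
  by rewrite (leq_trans _ (leq_trunc_div v s)) // leq_mul2r iv orbT.
have W0 : (0 < #|star v (block n s i)|)%N by rewrite cW.
have := deviation_hits mu_q (neg_logit p) W0 (ltW p_gt0) eta_gt0.
rewrite cW; apply: le_trans.
by apply: Pr_le => G; rewrite /hits card_star_adj // -ltNge.
Qed.

Lemma mean_atypical :
  \sum_G mu G * #|atypical G t K (typical p eta s)|%:R <=
    n%:R ^+ 2 / (2 * s%:R) * ((neg_logit p / eta) ^+ 2 * (s%:R^-1 + (q - p) ^+ 2)).
Proof.
set c := (neg_logit p / eta) ^+ 2 * _.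
have c0 : 0 <= c by rewrite mulr_ge0 ?addr_ge0 ?sqr_ge0 ?invr_ge0.
pose B := [set vi : 'I_n * 'I_n | (vi.2 < vi.1 %/ s)%N]%SET.
have -> : \sum_G mu G * #|atypical G t K (typical p eta s)|%:R =
    \sum_(vi in B) Pr mu [set G | ~~ typical p eta s #|block_nbrs G t K vi.1 vi.2|]%SET.
  under [RHS]eq_bigr => vi _ do rewrite PrE big_mkcond.
  rewrite exchange_big /=; apply: eq_bigr => G _.
  rewrite -big_mkcondr /= sumr_const mulr_natr; congr (_ *+ _).
  by apply: eq_card => vi; rewrite !inE [RHS]unfold_in inE.
apply: (@le_trans _ _ (\sum_(vi in B) c)).
  by apply: ler_sum => -[v i]; rewrite inE /= => iv; exact: Pr_atypical.
rewrite sumr_const -(mulr_natl c) ler_wpM2r //.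
by apply: le_trans (sum_divn_le s_gt0); rewrite ler_nat card_lt_divn.
Qed.

(** By [bp_le_blocks] this event forces more than x atypical pairs, and Markov's
    inequality applies to their number. *)
Lemma bp_tail x : 0 < x ->
  Pr mu [set G | n%:R ^+ 2 / (2 * s%:R) + n%:R * expR (s%:R * (entropy p + eta))
                 + K%:R * (x + n%:R) + n%:R * 2 ^+ t < (bp G)%:R]%SET <=
    n%:R ^+ 2 / (2 * s%:R) * ((neg_logit p / eta) ^+ 2 * (s%:R^-1 + (q - p) ^+ 2)) / x.
Proof.
move=> x0; pose X (G : graph n) : R := #|atypical G t K (typical p eta s)|%:R.
apply: (@le_trans _ _ (Pr mu [set G | x < X G]%SET)); last first.
  apply: (le_trans (markov (fun G => ler0n R _) x0)).
  by rewrite ler_wpM2r ?invr_ge0 ?(ltW x0) // mean_atypical.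
apply: Pr_le => G; rewrite !ltNge; apply: contra => Xx.
pose M := Num.truncn (expR (s%:R * (entropy p + eta))).
have hM (V : {set 'I_n}) : (#|V| <= s)%N ->
    (#|[set S : {set 'I_n} | (S \subset V) && typical p eta s #|S|]%SET| <= M)%N.
  by move=> Vs; rewrite Num.Theory.truncn_ge_nat ?expR_ge0 // card_typical.
have := bp_le_blocks G t_gt0 K_gt0 hM; rewrite -(ler_nat R) => /le_trans; apply.
rewrite 3!natrD; apply: lerD; [apply: lerD; first apply: lerD|].
- exact: sum_divn_le.
- by rewrite natrM ler_wpM2l // truncn_le // expR_ge0.
- by rewrite natrM natrD ler_wpM2l // lerD2r.
- by rewrite natrM natrX.
Qed.

End FixedSize.

(** * Asymptotics of the upper bound *)

Section RealEstimates.
Variable R : realType.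
Implicit Types (x y eps : R) (n t : nat).

Lemma near_ln_ge x : \forall n \near \oo%classic, x <= ln (n%:R : R).
Proof.
near=> n; rewrite -[leLHS]expRK ler_ln ?posrE ?expR_gt0 //; last first.
  by rewrite ltr0n; near: n; exact: nbhs_infty_ge.
near: n; exact: nbhs_infty_ger.
Unshelve. all: by end_near. Qed.

Lemma expRN_le y : 0 < y -> expR (- y) <= 4 / y ^+ 2.
Proof.
move=> y0; rewrite expRN -[leRHS]invrK lef_pV2 ?posrE ?expR_gt0 ?invr_gt0 ?divr_gt0 ?exprn_gt0 //.
rewrite invf_div; have E : expR y = expR (y / 2) ^+ 2.
  by rewrite -expRM_natl; congr expR; field.
have := expR_ge1Dx (y / 2); rewrite E; nra.
Qed.

Lemma exprn2_le_expR t : 2 ^+ t <= expR (t%:R : R).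
Proof.
rewrite -[t%:R]mulr1 expRM_natl lerXn2r ?nnegrE ?expR_ge0 //.
by have := expR_ge1Dx (1 : R); rewrite -natr1.
Qed.

(** With L = ln n and s = K t: the block length s is at least
    L / ((1 + eps / 2) H), which makes n^2 / (2 s) small enough, while both
    exp (s (H + eta)) and 2 ^ t are at most n^(1 - eta). *)
Lemma block_parameters (H eps : R) : 0 < H -> 0 < eps ->
  exists eta L0 : R, exists K : nat, [/\ 0 < eta, (0 < K)%N &
    forall L, L0 <= L -> exists t : nat,
      [/\ (0 < t)%N, L <= (1 + eps / 2) * H * (K * t)%:R,
          (K * t)%:R * (H + eta) <= (1 - eta) * L &
          2 ^+ t <= expR ((K * t)%:R * (H + eta))]].
Proof.
move=> H0 e0; (* eta is chosen so that D (1 - eta) exceeds H + eta by the fixed amount kap. *)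
pose D := (1 + eps / 2) * H.
have D0 : 0 < D by rewrite /D mulr_gt0 ?addr_gt0 ?divr_gt0.
pose kap := eps * H / 4; have kap0 : 0 < kap by rewrite /kap divr_gt0 ?mulr_gt0.
have D1 : 0 < D + 1 by rewrite addr_gt0.
pose eta := kap / (D + 1); have eta0 : 0 < eta by rewrite divr_gt0.
have etaE : eta * (D + 1) = kap by rewrite /eta divfK // gt_eqF.
have DE : D - H = 2 * kap by rewrite /D /kap; field.
have eta1 : eta < 1 by rewrite /eta ltr_pdivrMr // mul1r; lra.
pose c := H + eta; have c0 : 0 < c by rewrite addr_gt0.
(* K H >= 1 gives 2 ^ t <= exp t <= exp (s H). *)
pose K := (Num.truncn H^-1).+1.
have KH : 1 <= K%:R * H.
  by rewrite -ler_pdivrMr // div1r ltW // truncnS_gt.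
have K0 : 0 < K%:R :> R by rewrite ltr0n.
exists eta, (K%:R * c / (1 - eta) + D * (K%:R * c) / kap), K; split=> // L LL.
have u0 : 0 < K%:R * c by rewrite mulr_gt0.
have a0 : 0 < 1 - eta by rewrite subr_gt0.
have L1 : K%:R * c <= (1 - eta) * L.
  rewrite [leRHS]mulrC -ler_pdivrMr //; apply: le_trans LL.
  by rewrite lerDl ltW // divr_gt0 // mulr_gt0.
have L2 : D * (K%:R * c) <= kap * L.
  rewrite [leRHS]mulrC -ler_pdivrMr //; apply: le_trans LL.
  by rewrite lerDr ltW // divr_gt0.
pose y := (1 - eta) * L / (K%:R * c).
have y1 : 1 <= y by rewrite ler_pdivlMr // mul1r.
have /andP[ty yt] := truncn_itv (le_trans ler01 y1).
exists (Num.truncn y); rewrite truncn_gt0 y1 natrM -/c.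
move: ty yt; set T : R := (Num.truncn y)%:R.
rewrite -natr1 -/T ler_pdivlMr // ltr_pdivrMr // => ty yt.
have T0 : 0 <= T by rewrite ler0n.
split=> //.
- rewrite -/D -(ler_pM2l c0); have h := ler_wpM2l (ltW D0) (ltW yt).
  have E : D * ((1 - eta) * L) = (c + kap) * L.
    by rewrite mulrA; congr (_ * _); rewrite -etaE /c; move: etaE DE; lra.
  by rewrite E in h; move: h L2; rewrite mulrDl; lra.
- by move: ty; rewrite mulrCA mulrA.
- apply: le_trans (exprn2_le_expR _) _; rewrite ler_expR -/T mulrAC ler_peMl //.
  by apply: le_trans KH _; rewrite ler_wpM2l ?(ltW K0) // /c lerDl ltW.
Qed.

End RealEstimates.

Section UpperArithmetic.
Variable R : realType.

(** The four terms of [bp_tail], with m for n.  The first one is at most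
    (1 + eps / 2) H / 2 times m^2 / L, and the others share the remaining
    eps H / 4: two parts of 1/24 for the sets of leaves and two of 1/12 for the
    atypical pairs and the pairs within a block. *)
Lemma upper_sum_le (H eps eta L m s K E P : R) :
  0 < H -> 0 < eps -> 0 < eta -> 0 < K -> 0 < s -> 0 < L -> m = expR L ->
  L <= (1 + eps / 2) * H * s ->
  E <= expR ((1 - eta) * L) -> P <= expR ((1 - eta) * L) ->
  96 / (eps * H * eta ^+ 2) <= L -> 48 * K / (eps * H) <= L ->
  m ^+ 2 / (2 * s) + m * E + K * (eps * H * m ^+ 2 / (12 * K * L) + m) + m * P <=
    (1 + eps) * (H / 2 * (m ^+ 2 / L)).
Proof.
move=> H0 e0 eta0 K0 s0 L0 mE sL EL PL L1 L2.
have m0 : 0 < m by rewrite mE expR_gt0.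
have eH0 : 0 < eps * H by rewrite mulr_gt0.
pose Y := m ^+ 2 / L; have Y0 : 0 < Y by rewrite divr_gt0 ?exprn_gt0.
have h1 : m ^+ 2 / (2 * s) <= (1 + eps / 2) * H / 2 * Y.
  have -> : (1 + eps / 2) * H / 2 * Y = m ^+ 2 * ((1 + eps / 2) * H / (2 * L)).
    by rewrite /Y; field; rewrite gt_eqF.
  rewrite ler_wpM2l ?exprn_ge0 ?(ltW m0) // ler_pdivlMr ?mulr_gt0 // mulrC.
  by rewrite ler_pdivrMr ?mulr_gt0 //; nra.
have h2 x : x <= expR ((1 - eta) * L) -> m * x <= eps * H / 24 * Y.
  move=> xL; apply: (@le_trans _ _ (m * (m * (4 / (eta * L) ^+ 2)))).
    rewrite ler_wpM2l ?(ltW m0) // (le_trans xL) // mulrBl mul1r expRD -mE.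
    by rewrite ler_wpM2l ?(ltW m0) // expRN_le // mulr_gt0.
  have -> : m * (m * (4 / (eta * L) ^+ 2)) = 4 / (eta ^+ 2 * L) * Y.
    by rewrite /Y; field; rewrite !gt_eqF.
  rewrite ler_wpM2r ?(ltW Y0) //.
  move: L1; rewrite ler_pdivrMr ?mulr_gt0 ?exprn_gt0 // => L1.
  by rewrite ler_pdivrMr ?mulr_gt0 ?exprn_gt0 //; lra.
have h3 : K * m <= eps * H / 12 * Y.
  have mL : L ^+ 2 / 4 <= m.
    have := expRN_le L0; rewrite expRN -mE -[leRHS]invrK lef_pV2 ?posrE ?invr_gt0 //.
      by rewrite invf_div.
    by rewrite divr_gt0 ?exprn_gt0.
  have -> : eps * H / 12 * Y = m * (eps * H / 12 * (m / L)).
    by rewrite /Y; field; rewrite gt_eqF.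
  rewrite mulrC ler_wpM2l ?(ltW m0) //.
  have mL' : L / 4 <= m / L.
    by rewrite ler_pdivlMr // (le_trans _ mL) //; nra.
  move: L2; rewrite ler_pdivrMr // => L2.
  have := ler_wpM2l (ltW eH0) mL'; nra.
have h4 : K * (eps * H * m ^+ 2 / (12 * K * L)) = eps * H / 12 * Y.
  by rewrite /Y; field; rewrite !gt_eqF.
rewrite mulrDr h4; have := h2 _ EL; have := h2 _ PL.
have -> : (1 + eps) * (H / 2 * (m ^+ 2 / L)) = (1 + eps) * H / 2 * Y by rewrite /Y; ring.
move: h1 h3; lra.
Qed.

End UpperArithmetic.

Section Asymptotics.
Variables (R : realType) (p : R).
Hypotheses (p_gt0 : 0 < p) (p_lt1 : p < 1).
Variables (mu : forall n, graph n -> R) (q : nat -> R).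
Hypotheses (mu_q : \forall n \near \oo%classic, near_binomial (@mu n) (q n))
  (q_p : (q n @[n --> \oo] --> p)%classic).

Definition asymptotic_weight (n : nat) : R := entropy p / 2 * (n%:R ^+ 2 / ln n%:R).

Lemma near_sqr_dist c : 0 < c -> \forall n \near \oo%classic, (q n - p) ^+ 2 <= c.
Proof.
move=> c0; pose d := Num.min c 1; have d0 : 0 < d by rewrite lt_min c0 ltr01.
have /cvgrPdist_le/(_ _ d0) := q_p; apply: filterS => n; rewrite distrC => h.
have [dc d1] : d <= c /\ d <= 1 by rewrite !ge_min !lexx orbT.
rewrite -real_normK ?num_real //; apply: le_trans dc.
by apply: (le_trans _ h); rewrite expr2 ler_piMr // (le_trans h).
Qed.

Lemma bp_upper eps xi : 0 < eps -> 0 < xi ->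
  \forall n \near \oo%classic,
    Pr (@mu n) [set G | (1 + eps) * asymptotic_weight n < (bp G)%:R]%SET <= xi.
Proof.
move=> e0 xi0; have H0 := entropy_gt0 p_gt0 p_lt1; rewrite /asymptotic_weight.
move EH : (entropy p) H0 => H H0.
have [eta [L0 [K [eta0 K0 params]]]] := block_parameters H0 e0.
have [D DE] : exists D, D = (1 + eps / 2) * H by exists ((1 + eps / 2) * H).
have D0 : 0 < D by rewrite DE mulr_gt0 ?addr_gt0 ?divr_gt0.
have KR : (0 : R) < K%:R by rewrite ltr0n.
have eH0 : 0 < eps * H by rewrite mulr_gt0.
move lamE : ((neg_logit p / eta) ^+ 2) (sqr_ge0 (neg_logit p / eta)) => lam lam0.
have [c cE] : exists c, c = xi * (eps * H) / (6 * K%:R * D * (lam + 1)) by eexists.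
have den0 : 0 < 6 * K%:R * D * (lam + 1) by rewrite !mulr_gt0 // ltr_wpDl.
have c0 : 0 < c by rewrite cE divr_gt0 // mulr_gt0.
near=> n.
have mun : near_binomial (@mu n) (q n) by near: n.
have LL0 : L0 <= ln (n%:R : R) by near: n; exact: near_ln_ge.
have L1 : 96 / (eps * H * eta ^+ 2) <= ln (n%:R : R) by near: n; exact: near_ln_ge.
have L2 : 48 * K%:R / (eps * H) <= ln (n%:R : R) by near: n; exact: near_ln_ge.
have L3 : 2 * D / c <= ln (n%:R : R) by near: n; exact: near_ln_ge.
have n0 : (0 < n)%N by near: n; exact: nbhs_infty_ge.
have qp : (q n - p) ^+ 2 <= c / 2.
  by near: n; apply: near_sqr_dist; rewrite divr_gt0.
pose L : R := ln n%:R; rewrite -/L in LL0 L1 L2 L3.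
have Lgt0 : 0 < L by apply: lt_le_trans L3; rewrite divr_gt0 ?mulr_gt0.
have mE : (n%:R : R) = expR L by rewrite lnK // posrE ltr0n.
have nR0 : (0 : R) < n%:R by rewrite ltr0n.
have [t [t0 sL sE tE]] := params L LL0.
have s0 : (0 : R) < (K * t)%:R by rewrite ltr0n muln_gt0 K0.
(* x atypical pairs cost K x, a fixed small fraction of the main term. *)
pose x := eps * H * n%:R ^+ 2 / (12 * K%:R * L).
have x0 : 0 < x by rewrite /x divr_gt0 ?mulr_gt0 ?exprn_gt0.
have := bp_tail p_gt0 p_lt1 mun t0 K0 eta0 x0; rewrite EH lamE.
move: (K * t)%N s0 sL sE tE => s s0 sL sE tE tail.
apply: (@le_trans _ _ (n%:R ^+ 2 / (2 * s%:R) * (lam * (s%:R^-1 + (q n - p) ^+ 2)) / x)).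
  apply: le_trans tail; apply: (Pr_le mun) => G; apply: le_lt_trans.
  apply: upper_sum_le eta0 KR s0 Lgt0 mE sL _ _ L1 L2 => //.
    by rewrite ler_expR.
  by rewrite (le_trans tE) // ler_expR.
have Ls : L / D <= s%:R by rewrite ler_pdivrMr // mulrC DE.
have sV : s%:R^-1 <= c / 2.
  have L0D : 0 < L / D by rewrite divr_gt0.
  apply: (@le_trans _ _ (L / D)^-1); first by rewrite lef_pV2.
  rewrite invf_div ler_pdivrMr //; move: L3; rewrite ler_pdivrMr //; lra.
have -> : n%:R ^+ 2 / (2 * s%:R) * (lam * (s%:R^-1 + (q n - p) ^+ 2)) / x =
    6 * K%:R / (eps * H) * (L / s%:R) * (lam * (s%:R^-1 + (q n - p) ^+ 2)).
  rewrite /x; move: (s%:R) s0 (n%:R) nR0 (K%:R) KR => s' s0' n' n0' K' K0'.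
  by field; rewrite !gt_eqF.
have LsD : L / s%:R <= D by rewrite ler_pdivrMr // DE.
apply: (@le_trans _ _ (6 * K%:R / (eps * H) * D * ((lam + 1) * c))).
  have k0 : 0 < 6 * K%:R / (eps * H) by rewrite divr_gt0 ?mulr_gt0.
  have z0 : 0 <= s%:R^-1 + (q n - p) ^+ 2.
    by rewrite addr_ge0 ?invr_ge0 ?sqr_ge0 // ltW.
  apply: ler_pM.
  - by rewrite mulr_ge0 ?(ltW k0) // ltW // divr_gt0.
  - by rewrite mulr_ge0.
  - by rewrite ler_wpM2l // ltW.
  - by apply: ler_pM => //; [rewrite lerDl | move: sV qp; lra].
rewrite cE le_eqVlt; apply/orP; left; apply/eqP.
move: (K%:R) KR den0 => K' K0' den0.
by field; rewrite !gt_eqF // ltr_wpDl.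
Unshelve. all: by end_near. Qed.

End Asymptotics.

(** * The lower bound *)

Section LowerFixedSize.
Variables (R : realType) (p : R).
Hypotheses (p_gt0 : 0 < p) (p_lt1 : p < 1).

(** Either the number of edges is atypical, or the graph is one of the at most
    (4 n) ^ w graphs of small bc, each of which has small probability.  The
    hypotheses comparing q with p cost one of the two eta in the exponent, the
    typicality of the number of edges the other one. *)
Lemma bc_tail n (mu : graph n -> R) q eta w :
  near_binomial mu q -> (1 < n)%N -> 0 < eta ->
  q <= p * expR eta -> 1 - q <= (1 - p) * expR eta ->
  Pr mu [set G | (bc G <= w)%N]%SET <=
    (neg_logit p / eta) ^+ 2 * ('C(n, 2)%:R^-1 + (q - p) ^+ 2) +
    (4 * n%:R) ^+ w * ('C(n, 2).+1%:R * expR (- ('C(n, 2)%:R * (entropy p - 2 * eta)))).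
Proof.
move=> mu_q n1 eta0 qp qp'; have n0 : (0 < n)%N by rewrite ltnW.
have /andP[q0 q1] := nb_q mu_q; have q1' : 0 <= 1 - q by rewrite subr_ge0.
pose N := 'C(n, 2); pose T : {set edge n} := finset.setT.
have cT : #|T| = N by rewrite cardsT card_edge.
have N0 : (0 < #|T|)%N by rewrite cT bin_gt0.
pose atyp (G : graph n) := eta * N%:R < (hits R T G - p * N%:R) * - neg_logit p.
have := deviation_hits mu_q (- neg_logit p) N0 (ltW p_gt0) eta0.
rewrite cT mulNr sqrrN -/N => dev.
apply: (@le_trans _ _ (Pr mu [set G | atyp G]%SET +
    \sum_(G : graph n | (bc G <= w)%N && ~~ atyp G) mu G)).
  rewrite !PrE [leLHS](bigID atyp) /= lerD2r [leLHS]big_mkcond [leRHS]big_mkcond.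
  apply: ler_sum => G _; case: (atyp G); rewrite ?andbF ?andbT //.
  by case: ifP => // _; exact: nb_ge0 mu_q G.
apply: lerD => //; set e := N.+1%:R * _.
have e0 : 0 <= e by rewrite mulr_ge0 ?expR_ge0.
apply: (@le_trans _ _ (\sum_(G : graph n | (bc G <= w)%N) e)); last first.
  rewrite sumr_const -(mulr_natl e) ler_wpM2r //.
  have := card_small_bc w n0; rewrite -(ler_nat R) natrX natrM; apply: le_trans.
  by rewrite ler_nat; apply/eq_leq/eq_card => G; rewrite inE.
rewrite big_mkcondr /=; apply: ler_sum => G _; case: ifP => // +.
rewrite /atyp /hits finset.setIT -leNgt => ty.
have GN : (#|G| <= N)%N by rewrite -cT subset_leq_card ?finset.subsetT.
apply: le_trans (nb_le mu_q G) _; rewrite card_edge -/N ler_wpM2l //.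
apply: (@le_trans _ _ ((p * expR eta) ^+ #|G| * ((1 - p) * expR eta) ^+ (N - #|G|))).
  by apply: ler_pM; rewrite ?exprn_ge0 // lerXn2r ?nnegrE // ?(le_trans _ qp) ?(le_trans _ qp').
rewrite !exprMn mulrACA -exprD subnKC // bernoulli_weightE // -expRM_natl -expRD ler_expR.
move: ty; move: (#|G|%:R) (N%:R) => k M; lra.
Qed.

End LowerFixedSize.

Section LowerArithmetic.
Variable R : realType.

(** Here m stands for n, and the factors bound (4 n) ^ w, C(n, 2) + 1 and the
    probability of one graph, with eta = eps H / 8.  The exponent is
    - eps H m^2 / 4 plus terms of order m, hence at most - (eps H / 8) m for
    large L. *)
Lemma lower_exponent_le (H eps L m N w b : R) :
  0 < H -> 0 < eps -> eps < 1 -> 0 < L -> m = expR L ->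
  N = m * (m - 1) / 2 -> 0 <= w -> w <= (1 - eps) * (H / 2 * (m ^+ 2 / L)) ->
  8 / eps <= L -> (H / 2 + 2) * 8 / (eps * H) <= L -> 8 / (eps * H * b) <= L -> 0 < b ->
  expR (w * (L + 2)) * (expR (2 * L) * expR (- (N * (H - 2 * (eps * H / 8))))) <= b.
Proof.
move=> H0 e0 e1 L0 mE NE w0 wL L1 L2 L3 b0.
have m0 : 0 < m by rewrite mE expR_gt0.
have eH0 : 0 < eps * H by rewrite mulr_gt0.
have Lm : 1 + L <= m by rewrite mE expR_ge1Dx.
rewrite -!expRD.
have h1 : w * (L + 2) <= (1 - eps) * H / 2 * m ^+ 2 + eps * H / 8 * m ^+ 2.
  apply: (@le_trans _ _ ((1 - eps) * (H / 2 * (m ^+ 2 / L)) * (L + 2))).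
    by rewrite ler_wpM2r // addr_ge0 // ltW.
  have -> : (1 - eps) * (H / 2 * (m ^+ 2 / L)) * (L + 2) =
     (1 - eps) * H / 2 * m ^+ 2 + (1 - eps) * H * m ^+ 2 / L.
    by field; rewrite gt_eqF.
  rewrite lerD2l ler_pdivrMr //.
  move: L1; rewrite ler_pdivrMr // => L1.
  have m2 : 0 <= H * m ^+ 2 by rewrite mulr_ge0 ?exprn_ge0 ?ltW.
  have -> : eps * H / 8 * m ^+ 2 * L = (L * eps / 8) * (H * m ^+ 2) by ring.
  rewrite -mulrA ler_wpM2r //; lra.
pose c := eps * H / 8; have c0 : 0 < c by rewrite divr_gt0.
have h2 : (H / 2 + 2) * m <= c * m ^+ 2.
  rewrite expr2 mulrA ler_wpM2r ?(ltW m0) //.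
  move: L2; rewrite ler_pdivrMr // => L2.
  apply: (@le_trans _ _ (c * L)); first by rewrite /c; lra.
  by rewrite ler_wpM2l ?(ltW c0) //; lra.
have h3 : w * (L + 2) + (2 * L - N * (H - 2 * (eps * H / 8))) <= - (c * m).
  have cm : c * m <= c * m ^+ 2.
    by rewrite ler_wpM2l ?(ltW c0) // expr2 ler_peMl ?(ltW m0) //; lra.
  have -> : N * (H - 2 * (eps * H / 8)) = (H - 2 * c) / 2 * m ^+ 2 - (H - 2 * c) / 2 * m.
    by rewrite NE /c; field.
  move: h1; rewrite -/c => h1.
  have cE : (1 - eps) * H / 2 * m ^+ 2 = H / 2 * m ^+ 2 - 4 * c * m ^+ 2.
    by rewrite /c; field.
  have cm0 : 0 <= c * m by rewrite mulr_ge0 // ltW.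
  rewrite cE in h1; lra.
apply: (@le_trans _ _ (expR (- (c * m)))); first by rewrite ler_expR.
have cm0 : 0 < c * m by rewrite mulr_gt0.
rewrite expRN -[leRHS]invrK lef_pV2 ?posrE ?expR_gt0 ?invr_gt0 //.
apply: (@le_trans _ _ (c * m)); last first.
  by apply: le_trans (expR_ge1Dx _); lra.
apply: (@le_trans _ _ (c * L)); last by rewrite ler_wpM2l ?(ltW c0) //; lra.
move: L3; rewrite ler_pdivrMr ?mulr_gt0 // -[b^-1]div1r ler_pdivrMr // /c; lra.
Qed.

End LowerArithmetic.

Lemma bin2R (R : numFieldType) n : (0 < n)%N -> 'C(n, 2)%:R = n%:R * (n%:R - 1) / 2 :> R.
Proof.
move=> n0; have := mul_bin_diag n 1; rewrite bin1 => /(congr1 (fun k => k%:R : R)).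
by rewrite !natrM -subn1 natrB // => ->; rewrite mulrAC divff ?mul1r // pnatr_eq0.
Qed.

Section LowerAsymptotics.
Variables (R : realType) (p : R).
Hypotheses (p_gt0 : 0 < p) (p_lt1 : p < 1).
Variables (mu : forall n, graph n -> R) (q : nat -> R).
Hypotheses (mu_q : \forall n \near \oo%classic, near_binomial (@mu n) (q n))
  (q_p : (q n @[n --> \oo] --> p)%classic).


Lemma bc_lower eps xi : 0 < eps -> eps < 1 -> 0 < xi ->
  \forall n \near \oo%classic,
    Pr (@mu n) [set G | (bc G)%:R < (1 - eps) * asymptotic_weight p n]%SET <= xi.
Proof.
move=> e0 e1 xi0; have H0 := entropy_gt0 p_gt0 p_lt1; rewrite /asymptotic_weight.
have p1 : 0 < 1 - p by rewrite subr_gt0.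
have [eta etaE] : exists eta, eta = eps * entropy p / 8 by eexists.
have eta0 : 0 < eta by rewrite etaE divr_gt0 // mulr_gt0.
have eta_exp : 1 < expR eta by rewrite expR_gt1.
have [lam lamE] : exists lam, lam = (neg_logit p / eta) ^+ 2 by eexists.
have lam0 : 0 <= lam by rewrite lamE sqr_ge0.
have [c cE] : exists c, c = xi / (4 * (lam + 1)) by eexists.
have c0 : 0 < c by rewrite cE divr_gt0 // mulr_gt0 // ltr_wpDl.
have b0 : 0 < xi / 2 by rewrite divr_gt0.
near=> n.
have mun : near_binomial (@mu n) (q n) by near: n.
have L1 : 8 / eps <= ln (n%:R : R) by near: n; exact: near_ln_ge.
have L2 : (entropy p / 2 + 2) * 8 / (eps * entropy p) <= ln (n%:R : R).
  by near: n; exact: near_ln_ge.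
have L3 : 8 / (eps * entropy p * (xi / 2)) <= ln (n%:R : R).
  by near: n; exact: near_ln_ge.
have L4 : c^-1 <= ln (n%:R : R) by near: n; exact: near_ln_ge.
have n1 : (1 < n)%N by near: n; exact: nbhs_infty_ge.
have qp : (q n - p) ^+ 2 <= c by near: n; exact: near_sqr_dist.
have q_le : q n <= p * expR eta.
  by near: n; apply: (cvgr_le _ q_p); rewrite ltr_pMr.
have q_ge : 1 - (1 - p) * expR eta <= q n.
  by near: n; apply: (cvgr_ge _ q_p); rewrite ltrBlDr -ltrBlDl ltr_pMr.
have n0 : (0 : R) < n%:R by rewrite ltr0n ltnW.
move mE : (ln (n%:R : R)) L1 L2 L3 L4 => L L1 L2 L3 L4.
have {}mE : (n%:R : R) = expR L by rewrite -mE lnK // posrE.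
have L0 : 0 < L by apply: lt_le_trans L4; rewrite invr_gt0.
have H_target : 0 <= (1 - eps) * (entropy p / 2 * (n%:R ^+ 2 / L)).
  apply: mulr_ge0; first by rewrite subr_ge0 ltW.
  by apply: mulr_ge0; apply: divr_ge0; rewrite ?exprn_ge0 ?ltW.
have /andP[wle _] := truncn_itv H_target.
set w := Num.truncn _ in wle.
apply: (@le_trans _ _ (Pr (@mu n) [set G | (bc G <= w)%N]%SET)).
  by apply: (Pr_le mun) => G /ltW; rewrite /w truncn_ge_nat.
apply: le_trans (bc_tail p_gt0 p_lt1 w mun n1 eta0 q_le _) _.
  by move: q_ge; lra.
have NE := bin2R R (ltnW n1).
have nL : 1 + L <= n%:R by rewrite mE expR_ge1Dx.
have n2 : 2 <= n%:R :> R by rewrite ler_nat.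
have NL : L <= 'C(n, 2)%:R by rewrite NE; nra.
have part1 : (neg_logit p / eta) ^+ 2 * ('C(n, 2)%:R^-1 + (q n - p) ^+ 2) <= xi / 2.
  rewrite -lamE; apply: (@le_trans _ _ ((lam + 1) * (c + c))).
    have Nc : 'C(n, 2)%:R^-1 <= c.
      rewrite -[c]invrK lef_pV2 ?posrE ?invr_gt0 ?(le_trans L4) //.
      exact: lt_le_trans NL.
    apply: ler_pM => //; [by rewrite addr_ge0 ?invr_ge0 ?sqr_ge0|by rewrite lerDl|].
    exact: lerD.
  rewrite cE le_eqVlt; apply/orP; left; apply/eqP; field.
  by rewrite gt_eqF // ltr_wpDl.
have part2 : (4 * n%:R) ^+ w * ('C(n, 2).+1%:R *
    expR (- ('C(n, 2)%:R * (entropy p - 2 * eta)))) <= xi / 2.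
  have wR : 0 <= w%:R :> R by rewrite ler0n.
  apply: le_trans (lower_exponent_le H0 e0 e1 L0 mE NE wR wle L1 L2 L3 b0).
  rewrite etaE; apply: ler_pM; rewrite ?exprn_ge0 ?mulr_ge0 ?expR_ge0 //.
    rewrite expRM_natl lerXn2r ?nnegrE ?mulr_ge0 ?expR_ge0 // expRD -mE mulrC.
    rewrite ler_wpM2l // ?(ltW n0) //; have := exprn2_le_expR R 2; lra.
  rewrite ler_wpM2r ?expR_ge0 // -natr1 NE expRM_natl -mE; nra.
by rewrite [leRHS]splitr lerD.
Unshelve. all: by end_near. Qed.

End LowerAsymptotics.

(** * From fixed precision to asymptotic equivalence *)

Section SimWhp.
Variables (R : realType) (mu : forall n, graph n -> R) (q : nat -> R).
Hypothesis mu_q : \forall n \near \oo%classic, near_binomial (@mu n) (q n).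

Lemma Pr_compl n (P : pred (graph n)) : near_binomial (@mu n) (q n) ->
  Pr (@mu n) [set G | ~~ P G]%SET = 1 - Pr (@mu n) [set G | P G]%SET.
Proof.
move=> mun; rewrite !PrE -(nb_sum mun) [in RHS](bigID P) /=.
by rewrite addrAC subrr add0r.
Qed.

(** The o(1) bound [delta n] is, up to 1 / (n + 1), the smallest e for which
    precision e fails with probability at most e. *)
Lemma sim_whp_intro (X Y : forall n, graph n -> R) :
  (forall eps xi, 0 < eps -> 0 < xi -> \forall n \near \oo%classic,
     Pr (@mu n) [set G | eps * `|Y n G| < `|X n G - Y n G|]%SET <= xi) ->
  sim_whp mu X Y.
Proof.
move=> XY; pose bad n e := Pr (@mu n) [set G | e * `|Y n G| < `|X n G - Y n G|]%SET.
pose E n : set R := [set e | 0 < e /\ bad n e <= e]%classic.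
pose delta n : R := inf (E n) + n.+1%:R^-1.
have lbE n : has_lbound (E n) by exists 0 => e [/ltW].
have infE0 n : 0 <= inf (E n).
  have [ne|/set0P/negP/negPn/eqP->] := pselect (E n !=set0)%classic; last by rewrite inf0.
  by apply: lb_le_inf => // e [/ltW].
have delta_to0 : (delta n @[n --> \oo] --> (0 : R))%classic.
  apply/cvgrPdist_le => e e0; have e2 : 0 < e / 2 by rewrite divr_gt0.
  have := near_infty_natSinv_lt (PosNum e2); have := XY _ _ e2 e2.
  apply: filterS2 => n En /ltW /= ne.
  rewrite sub0r normrN ger0_norm ?addr_ge0 ?invr_ge0 // [leRHS]splitr lerD //.
  exact: ge_inf.
exists delta; split=> //; apply/cvgrPdist_le => e e0.
move/cvgrPdist_le: delta_to0 => /(_ _ e0); apply: filterS2 mu_q => n mun.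
rewrite sub0r normrN => de.
have Pr_le1 P : Pr (@mu n) [set G | P G]%SET <= 1.
  rewrite PrE -(nb_sum mun) [leRHS](bigID P) /= lerDl.
  by apply: sumr_ge0 => G _; exact: nb_ge0 mun G.
have Pr_ge0 P : 0 <= Pr (@mu n) [set G | P G]%SET.
  by rewrite PrE; apply: sumr_ge0 => G _; exact: nb_ge0 mun G.
have [x [x0 xb] xd] : exists2 x, E n x & x < delta n.
  by apply: inf_adherent; [rewrite invr_gt0 | split=> //; exists 1; split; rewrite ?Pr_le1].
have badd : bad n (delta n) <= delta n.
  apply: le_trans (ltW xd); apply: le_trans xb; apply: (Pr_le mun) => G.
  by apply: le_lt_trans; rewrite ler_wpM2r // ltW.
have -> : Pr (@mu n) [set G | `|X n G - Y n G| <= delta n * `|Y n G|]%SET = 1 - bad n (delta n).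
  rewrite -Pr_compl //; congr Pr; apply/setP => G; by rewrite !inE -leNgt.
rewrite opprB addrC subrK ger0_norm ?Pr_ge0 //.
by rewrite (le_trans badd) // (le_trans _ de) // ler_norm.
Qed.

End SimWhp.

Section NearBinomialLaws.
Variables (R : realType) (p : R).
Hypotheses (p_gt0 : 0 < p) (p_lt1 : p < 1).
Variables (mu : forall n, graph n -> R) (q : nat -> R).
Hypotheses (mu_q : \forall n \near \oo%classic, near_binomial (@mu n) (q n))
  (q_p : (q n @[n --> \oo] --> p)%classic).

Lemma h2_asymptotic_weight n : h2 p / 2 * (n%:R ^+ 2 / lg n%:R) = asymptotic_weight p n.
Proof.
rewrite /h2 /asymptotic_weight /lg invf_div /entropy.
have : ln (2 : R) != 0 by rewrite gt_eqF // ln_gt0 // ltr1n.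
move: (ln 2) (ln p) (ln (1 - p)) (ln n%:R)^-1 (n%:R ^+ 2) => l2 a b c d l2_neq0.
by field.
Qed.

Lemma asymptotic_weight_ge0 n : 0 <= asymptotic_weight p n.
Proof.
have H0 := entropy_gt0 p_gt0 p_lt1; rewrite /asymptotic_weight.
have [n0|n0] := leqP n 0; first by move: n0; rewrite leqn0 => /eqP->; rewrite expr0n mul0r mulr0.
apply: mulr_ge0; first by rewrite divr_ge0 // ltW.
by rewrite divr_ge0 ?exprn_ge0 // ln_ge0 // ler1n.
Qed.

(** Off this event, (1 - eps) f <= bc <= bp <= (1 + eps) f with f the claimed
    value, which gives both asymptotic equivalences at once. *)
Lemma bc_bp_sandwich eps xi : 0 < eps -> eps < 1 -> 0 < xi ->
  \forall n \near \oo%classic,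
    Pr (@mu n) [set G | ((1 + eps) * asymptotic_weight p n < (bp G)%:R) ||
                        ((bc G)%:R < (1 - eps) * asymptotic_weight p n)]%SET <= xi.
Proof.
move=> e0 e1 xi0; have x2 : 0 < xi / 2 by rewrite divr_gt0.
have up := bp_upper p_gt0 p_lt1 mu_q q_p e0 x2.
have lo := bc_lower p_gt0 p_lt1 mu_q q_p e0 e1 x2.
near=> n; have mun : near_binomial (@mu n) (q n) by near: n.
rewrite [leRHS]splitr; apply: (@le_trans _ _
  (Pr (@mu n) [set G | (1 + eps) * asymptotic_weight p n < (bp G)%:R]%SET +
   Pr (@mu n) [set G | (bc G)%:R < (1 - eps) * asymptotic_weight p n]%SET)); last first.
  by apply: lerD; near: n.
rewrite !PrE [leLHS]big_mkcond [X in _ <= X + _]big_mkcond [X in _ <= _ + X]big_mkcond.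
rewrite -big_split /=; apply: ler_sum => G _.
have m0 := nb_ge0 mun G.
by case: ifP => [/orP[]->|_]; rewrite ?lerDl ?lerDr; do ?case: ifP; rewrite ?addr_ge0.
Unshelve. all: by end_near. Qed.

Lemma sim_whp_near_binomial :
  sim_whp mu (fun n G => (bc G)%:R) (fun n G => (bp G)%:R) /\
  sim_whp mu (fun n G => (bp G)%:R) (fun n G => h2 p / 2 * (n%:R ^+ 2 / lg n%:R)).
Proof.
split; apply: (sim_whp_intro mu_q) => eps xi e0 xi0.
  pose d : R := Num.min eps 1 / 4.
  have [d0 d4 d14] : [/\ 0 < d, 4 * d <= eps & 4 * d <= 1].
    have : Num.min eps 1 <= 1 by rewrite ge_min lexx orbT.
    have : Num.min eps 1 <= eps by rewrite ge_min lexx.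
    have : 0 < Num.min eps 1 by rewrite lt_min e0 ltr01.
    by rewrite /d; split; lra.
  have d1 : d < 1 by lra.
  have := bc_bp_sandwich d0 d1 xi0; apply: filterS2 mu_q => n mun; apply: le_trans.
  apply: (Pr_le mun) => G; apply: contraTT; rewrite negb_or -!leNgt => /andP[up lo].
  have f0 := asymptotic_weight_ge0 n.
  have bcp : (bc G)%:R <= (bp G)%:R :> R by rewrite ler_nat bc_le_bp.
  have h1 : 4 * d * (bp G)%:R <= eps * (bp G)%:R by rewrite ler_wpM2r.
  have h2 := ler_wpM2l (ltW d0) (le_trans lo bcp).
  have df : 0 <= d * asymptotic_weight p n by rewrite mulr_ge0 // ltW.
  have h3 := ler_wpM2r df d14.
  rewrite distrC !ger0_norm ?subr_ge0 //; lra.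
pose d : R := Num.min eps 1 / 2.
have [d0 d1 de] : [/\ 0 < d, d < 1 & d <= eps].
  have : Num.min eps 1 <= 1 by rewrite ge_min lexx orbT.
  have : Num.min eps 1 <= eps by rewrite ge_min lexx.
  have : 0 < Num.min eps 1 by rewrite lt_min e0 ltr01.
  by rewrite /d; split; lra.
have := bc_bp_sandwich d0 d1 xi0; apply: filterS2 mu_q => n mun; apply: le_trans.
apply: (Pr_le mun) => G; rewrite h2_asymptotic_weight; apply: contraTT; rewrite negb_or -!leNgt => /andP[up lo].
have f0 := asymptotic_weight_ge0 n; rewrite (ger0_norm f0).
have bcp : (bc G)%:R <= (bp G)%:R :> R by rewrite ler_nat bc_le_bp.
have df : d * asymptotic_weight p n <= eps * asymptotic_weight p n by rewrite ler_wpM2r.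
by rewrite ler_norml; apply/andP; split; lra.
Qed.

End NearBinomialLaws.

Section EdgeDensity.
Variables (R : realType) (p : R).
Hypotheses (p_gt0 : 0 < p) (p_lt1 : p < 1).

Implicit Type n : nat.

Lemma truncn_density_le n : (Num.truncn (p * 'C(n, 2)%:R) <= 'C(n, 2))%N.
Proof.
have pC : 0 <= p * 'C(n, 2)%:R by rewrite mulr_ge0 // ltW.
rewrite -(ler_nat R) (le_trans (y := p * 'C(n, 2)%:R)) ?truncn_le //.
by rewrite ler_piMl // ltW.
Qed.

Lemma truncn_density_cvg :
  ((Num.truncn (p * 'C(n, 2)%:R))%:R / 'C(n, 2)%:R @[n --> \oo] --> p)%classic.
Proof.
apply/cvgrPdist_le => e e0; near=> n.
have n2 : (2 < n)%N by near: n; exact: nbhs_infty_ge.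
have nN : (n <= 'C(n, 2))%N.
  by rewrite bin2; have := mul_bin_diag n 1; rewrite bin1 bin2; nia.
have N0 : (0 : R) < 'C(n, 2)%:R by rewrite ltr0n bin_gt0 ltnW.
have ne : e^-1 <= 'C(n, 2)%:R.
  apply: (@le_trans _ _ n%:R); last by rewrite ler_nat.
  by near: n; exact: nbhs_infty_ger.
have pC : 0 <= p * 'C(n, 2)%:R by rewrite mulr_ge0 // ltW.
have /andP[] := truncn_itv pC; rewrite -natr1.
move: (Num.truncn _) => m; move: ('C(n, 2)%:R) N0 ne => N N0 ne mp pm.
have -> : p - m%:R / N = (p * N - m%:R) / N by rewrite mulrBl mulfK // gt_eqF.
rewrite ger0_norm ?divr_ge0 ?subr_ge0 ?(ltW N0) // ler_pdivrMr //.
apply: (@le_trans _ _ 1); first by rewrite lerBlDl ltW.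
by rewrite mulrC -ler_pdivrMr // div1r.
Unshelve. all: by end_near. Qed.

End EdgeDensity.

Theorem mainTheorem10 (R : realType) (p : R) (p_gt0 : 0 < p) (p_lt1 : p < 1) :
  let m (n : nat) : nat := Num.truncn (p * 'C(n, 2)%:R) in
  let bcR (n : nat) (G : graph n) : R := (bc G)%:R in
  let bpR (n : nat) (G : graph n) : R := (bp G)%:R in
  let f (n : nat) (G : graph n) : R := h2 p / 2 * (n%:R ^+ 2 / lg n%:R) in
  (sim_whp (fun n => @Gnm R n (m n)) bcR bpR /\
   sim_whp (fun n => @Gnm R n (m n)) bpR f) /\
  (sim_whp (fun n => @Gnp R p n) bcR bpR /\
   sim_whp (fun n => @Gnp R p n) bpR f).
Proof.
move=> m bcR bpR f.
have p01 : 0 <= p <= 1 by rewrite !ltW.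
split; last first.
  apply: (sim_whp_near_binomial p_gt0 p_lt1 (q := fun=> p)); last exact: cvg_cst.
  by near=> n; exact: Gnp_near_binomial.
apply: (sim_whp_near_binomial p_gt0 p_lt1) (truncn_density_cvg p_gt0 p_lt1).
near=> n; apply: Gnm_near_binomial; last exact: truncn_density_le.
by rewrite bin_gt0; near: n; exact: nbhs_infty_ge.
Unshelve. all: by end_near. Qed.
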